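(* Let $V\in L^\infty(0,2\pi)$ be complex-valued with imaginary part $V_I$ satisfying $V_I(x)\geq0$ for almost every $x$ and $V_I(x)>0$ on a set of positive Lebesgue measure. Let $\rho\in\mathbb{C}$ and $k\in L^2(0,2\pi)$ be such that $A_{\rho,k}$ is a maximally dissipative extension of $A_{min}$. Then: (i) If $\lambda\in\sigma(A_{\rho,k})\cap\mathbb{R}$, then $m_a(\lambda,A_{\rho,k})=1$. (ii) $\sigma(A_{\rho,k})$ contains at most one real point. (iii) For a given $\lambda\in\mathbb{R}$, there exists at most one maximally dissipative extension of $A_{min}$ of the form $A_{\rho,k}$ (i.e. at most one such pair $(\rho,k)$) with $\lambda\in\sigma(A_{\rho,k})$. (iv) If $A_{\rho,k}$ has a real eigenvalue $\lambda$, then the corresponding eigenspace is orthogonal to the root spaces corresponding to all other eigenvalues of $A_{\rho,k}$.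
   Context: The Hilbert space is $L^2(0,2\pi)$ (complex-valued functions). The minimal operator is $A_{min}f=if'+Vf$ on $\mathrm{dom}(A_{min})=\{f\in H^1(0,2\pi)\mid f(0)=f(2\pi)=0\}$. For $\rho\in\mathbb{C}$, $k\in L^2(0,2\pi)$, $$\mathrm{dom}(A_{\rho,k})=\{f\in H^1(0,2\pi)\mid f(0)=\rho f(2\pi)\},\qquad (A_{\rho,k}f)(x)=if'(x)+V(x)f(x)+f(2\pi)k(x).$$ With inner product linear in the second argument, a densely defined operator $A$ is dissipative if $\mathrm{Im}\langle f,Af\rangle\geq0$ for all $f\in\mathrm{dom}(A)$, and maximally dissipative if it is dissipative and has no non-trivial dissipative operator extension. For an eigenvalue $\lambda$ of $A$, the root space is $\mathcal{R}(\lambda,A)=\{f\mid\exists j\in\mathbb{N}\text{ such that }(A-\lambda)^jf=0\}$ and the algebraic multiplicity is $m_a(\lambda,A)=\dim\mathcal{R}(\lambda,A)$. *)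

(* Defs.v *)
From HB Require Import structures.
From mathcomp Require Import all_boot all_order all_algebra.
From mathcomp Require Import complex.
From mathcomp Require Import all_classical all_reals all_analysis measurable_realfun.
From mathcomp Require Import lra ring.

Set Implicit Arguments.
Unset Strict Implicit.
Unset Printing Implicit Defensive.
Import Order.TTheory GRing.Theory Num.Theory.
Import numFieldNormedType.Exports.
Local Open Scope classical_set_scope.
Local Open Scope complex_scope.
Local Open Scope quotient_scope.
Local Open Scope ring_scope.

Section Operators.
Variables (R : realType) (H : lmodType R[i]) (ip : H -> H -> R[i]).

(* An unbounded operator is identified with its graph. *)
Definition graph := set (H * H).

Implicit Types (A B : graph) (lam : R[i]).

Definition linear_operator A : Prop :=
  [/\ A (0, 0),
      forall (a : R[i]) (f f' g g' : H),
        A (f, g) -> A (f', g') -> A (a *: f + f', a *: g + g') &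
      forall f g g' : H, A (f, g) -> A (f, g') -> g = g'].

Definition dom A : set H := [set f | exists g, A (f, g)].

Definition hnorm (f : H) : R := Num.sqrt (complex.Re (ip f f)).

Definition densely_defined A : Prop :=
  forall (f : H) (e : R), 0 < e -> exists2 g, dom A g & hnorm (f - g) < e.

Definition dissipative A : Prop :=
  [/\ linear_operator A, densely_defined A &
      forall f g : H, A (f, g) -> 0 <= complex.Im (ip f g)].

(* Inclusion of graphs [A `<=` B] says that the operator B extends A. *)
Definition maximally_dissipative A : Prop :=
  dissipative A /\ forall B, dissipative B -> A `<=` B -> B = A.

(* The operator A - lam: its graph contains (f, h) iff A f = h + lam f. *)
Definition shift_op A lam : graph := [set p | A (p.1, p.2 + lam *: p.1)].

Definition resolvent_set A : set R[i] :=
  [set lam | (forall h : H, exists! f : H, shift_op A lam (f, h)) /\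
             exists M : R, forall f h : H,
               shift_op A lam (f, h) -> hnorm f <= M * hnorm h].

Definition spectrum A : set R[i] := ~` resolvent_set A.

Definition op_eigenspace A lam : set H := [set f | shift_op A lam (f, 0)].

Definition op_eigenvalue A lam : Prop := exists2 f, op_eigenspace A lam f & f != 0.

Fixpoint op_iter A (j : nat) : graph :=
  if j is j'.+1 then
    [set p | exists2 h, A (p.1, h) & op_iter A j' (h, p.2)]
  else [set p | p.1 = p.2].

Definition root_space A lam : set H :=
  [set f | exists j : nat, op_iter (shift_op A lam) j (f, 0)].

Definition has_dim (S : set H) (n : nat) : Prop :=
  exists e : 'I_n -> H,
    (forall a : 'I_n -> R[i], \sum_i a i *: e i = 0 -> forall i, a i = 0) /\
    S = [set f | exists a : 'I_n -> R[i], f = \sum_i a i *: e i].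

Definition algebraic_multiplicity A lam (n : nat) : Prop :=
  has_dim (root_space A lam) n.

End Operators.

Section L2Operators.
Variable R : realType.
Implicit Types (D : set R) (f : R -> R[i]).

Definition twopi : R := 2 * pi.

Definition itv02pi : set R := `]0, twopi[.

Lemma measurable_itv02pi : measurable itv02pi.
Proof. exact: measurable_itv. Qed.

Local Notation leb := (@lebesgue_measure R).

Definition cmeasurable D f : Prop :=
  measurable_fun D (fun x => complex.Re (f x)) /\
  measurable_fun D (fun x => complex.Im (f x)).

Definition cintegral D f : R[i] :=
  (\int[leb]_(x in D) complex.Re (f x))%R +i*
  (\int[leb]_(x in D) complex.Im (f x))%R.

Definition sqmod (z : R[i]) : R := Normc.normc z ^+ 2.

Definition is_L2 f : Prop :=
  cmeasurable itv02pi f /\ (\int[leb]_(x in itv02pi) (sqmod (f x))%:E < +oo)%E.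

Definition is_Linfty f : Prop :=
  cmeasurable itv02pi f /\
  exists M : R, {ae leb, forall x, itv02pi x -> Normc.normc (f x) <= M}.

Lemma sqmodE z : sqmod z = complex.Re z ^+ 2 + complex.Im z ^+ 2.
Proof. by case: z => a b; rewrite /sqmod /= sqr_sqrtr// addr_ge0// sqr_ge0. Qed.

Lemma sqmod_ge0 z : 0 <= sqmod z.
Proof. by rewrite sqmodE addr_ge0// sqr_ge0. Qed.

Lemma measurable_sqmod D f : cmeasurable D f ->
  measurable_fun D (fun x => (sqmod (f x))%:E : \bar R).
Proof.
move=> [m1 m2]; apply/measurable_EFinP.
rewrite (_ : (fun x => _) = (fun x => complex.Re (f x) ^+ 2 + complex.Im (f x) ^+ 2)); last first.
  by apply/funext => x; rewrite sqmodE.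
by apply: measurable_funD; apply: measurable_funX.
Qed.

Lemma cmeasurable_lin D (a : R[i]) f g : cmeasurable D f -> cmeasurable D g ->
  cmeasurable D (a *: f + g).
Proof.
case: a => a b [f1 f2] [g1 g2]; split.
- rewrite (_ : (fun x => _) = (fun x =>
     (a * complex.Re (f x) - b * complex.Im (f x)) + complex.Re (g x))); last first.
    apply/funext => x; change (complex.Re ((a +i* b) * f x + g x) =
      (a * complex.Re (f x) - b * complex.Im (f x)) + complex.Re (g x)).
    by case: (f x); case: (g x).
  apply: measurable_funD => //.
  by apply: measurable_funB; apply: measurable_funM => //; exact: measurable_cst.
- rewrite (_ : (fun x => _) = (fun x =>
     (a * complex.Im (f x) + b * complex.Re (f x)) + complex.Im (g x))); last first.
    apply/funext => x; change (complex.Im ((a +i* b) * f x + g x) =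
      (a * complex.Im (f x) + b * complex.Re (f x)) + complex.Im (g x)).
    by case: (f x); case: (g x).
  apply: measurable_funD => //.
  by apply: measurable_funD; apply: measurable_funM => //; exact: measurable_cst.
Qed.

Lemma sqmod_lin a z w : sqmod (a * z + w) <= 2 * sqmod a * sqmod z + 2 * sqmod w.
Proof.
rewrite !sqmodE; case: a z w => [a b] [x y] [u v] /=.
have := sqr_ge0 (a * x - b * y - u); have := sqr_ge0 (a * y + b * x - v).
nra.
Qed.

Lemma is_L2_0 : is_L2 0.
Proof.
split; first by split; exact: measurable_cst.
rewrite integral0_eq ?ltry// => x _.
by rewrite sqmodE /= expr0n /= addr0.
Qed.

Lemma is_L2_lin (a : R[i]) f g : is_L2 f -> is_L2 g -> is_L2 (a *: f + g).
Proof.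
move=> [mf hf] [mg hg]; split; first exact: cmeasurable_lin.
have mI := measurable_itv02pi.
have s0 z : (0 <= (sqmod z)%:E)%E by rewrite lee_fin sqmod_ge0.
have c0 : (0 <= (2 * sqmod a)%:E)%E by rewrite lee_fin mulr_ge0// sqmod_ge0.
have t0 : (0 <= (2 : R)%:E)%E by rewrite lee_fin.
have mcf : measurable_fun itv02pi (fun x => ((2 * sqmod a)%:E * (sqmod (f x))%:E)%E).
  by apply: emeasurable_funM; [exact: measurable_cst | exact: measurable_sqmod].
have mcg : measurable_fun itv02pi (fun x => ((2 : R)%:E * (sqmod (g x))%:E)%E).
  by apply: emeasurable_funM; [exact: measurable_cst | exact: measurable_sqmod].
apply: (@le_lt_trans _ _ (\int[leb]_(x in itv02pi)
   ((2 * sqmod a)%:E * (sqmod (f x))%:E + (2 : R)%:E * (sqmod (g x))%:E))%E).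
  apply: ge0_le_integral => //.
  - by apply: measurable_sqmod; apply: cmeasurable_lin.
  - exact: emeasurable_funD.
  - by move=> x _; rewrite -!EFinM -EFinD lee_fin sqmod_lin.
rewrite ge0_integralD//; try by move=> x _; exact: mule_ge0.
rewrite !ge0_integralZl//; try by move=> *; exact: s0.
by rewrite lte_add_pinfty// lte_mul_pinfty.
- exact: measurable_sqmod.
- exact: measurable_sqmod.
Qed.

Definition L2pred : {pred R -> R[i]} := [pred f | `[< is_L2 f >]].

Lemma L2pred_submod : submod_closed L2pred.
Proof.
split; first by apply/asboolP; exact is_L2_0.
by move=> a f g /asboolP hf /asboolP hg; apply/asboolP; exact (is_L2_lin a hf hg).
Qed.

HB.instance Definition _ :=
  GRing.isSubmodClosed.Build R[i] (R -> R[i]) L2pred L2pred_submod.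

Record L2fun := MkL2fun { L2val :> R -> R[i]; L2valP : L2val \in L2pred }.

HB.instance Definition _ := [isSub for L2val].
HB.instance Definition _ := [Choice of L2fun by <:].
HB.instance Definition _ := [SubChoice_isSubLmodule of L2fun by <:].

Definition null_pred : {pred L2fun} :=
  [pred f : L2fun | `[< {ae leb, forall x, itv02pi x -> f x = 0} >]].

Lemma null_submod : submod_closed null_pred.
Proof.
split; first by apply/asboolP; apply: aeW.
move=> a f g /asboolP hf /asboolP hg; apply/asboolP.
have F : Filter (nbhs (almost_everywhere leb)) by apply: ae_filter_ringOfSetsType.
apply: (filterS2 _ _ hf hg) => x hfx hgx Ix.
by change (a * f x + g x = 0); rewrite hfx// hgx// mulr0 addr0.
Qed.

HB.instance Definition _ :=
  GRing.isSubmodClosed.Build R[i] L2fun null_pred null_submod.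

(* L^2(0, 2 pi): square integrable functions modulo almost everywhere
   equality on (0, 2 pi). *)
Definition L2 := Quotient.quot null_pred.

HB.instance Definition _ := GRing.Zmodule.on L2.
HB.instance Definition _ := EqQuotient.on L2.

Definition L2_scale (a : R[i]) : L2 -> L2 := lift_op1 L2 ( *:%R a).

Lemma pi_L2_scale (a : R[i]) :
  {morph \pi_L2 : f / (a *: f : L2fun) >-> L2_scale a f}.
Proof.
move=> f; unlock L2_scale; apply/eqP; rewrite piE /= /Quotient.equiv.
have /eqP := reprK (\pi_L2 f); rewrite piE /Quotient.equiv => h.
by rewrite -scalerBr rpredZ// -opprB rpredN.
Qed.

Lemma pi_L2D : {morph \pi_L2 : f g / (f + g : L2fun) >-> f + g}.
Proof. by move=> f g; rewrite !piE. Qed.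

Lemma L2_scaleA a b v : L2_scale a (L2_scale b v) = L2_scale (a * b) v.
Proof. by elim/quotW: v => v; rewrite -!pi_L2_scale scalerA. Qed.

Lemma L2_scale1 : left_id 1 L2_scale.
Proof. by elim/quotW => v; rewrite -!pi_L2_scale scale1r. Qed.

Lemma L2_scaleDr : right_distributive L2_scale +%R.
Proof.
move=> a; elim/quotW => v; elim/quotW => w.
by rewrite -pi_L2D -!pi_L2_scale scalerDr pi_L2D.
Qed.

Lemma L2_scaleDl v : {morph L2_scale^~ v : a b / a + b}.
Proof.
move=> a b; elim/quotW: v => v.
by rewrite -!pi_L2_scale scalerDl pi_L2D.
Qed.

HB.instance Definition _ := GRing.Zmodule_isLmodule.Build R[i] L2
  L2_scaleA L2_scale1 L2_scaleDr L2_scaleDl.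

Definition L2repr (f : L2) : R -> R[i] := repr f.

Definition ip2 (f g : L2) : R[i] :=
  cintegral itv02pi (fun x => ((L2repr f x)^*)%C * L2repr g x).

Definition represents (u : R -> R[i]) (f : L2) : Prop :=
  L2repr f = u %[ae leb in itv02pi].

Lemma represents_ex u : is_L2 u -> exists f : L2, represents u f.
Proof.
move=> hu; have pu : u \in L2pred by apply/asboolP.
exists (\pi_L2 (MkL2fun pu)); rewrite /represents /L2repr.
have /eqP := reprK (\pi_L2 (MkL2fun pu)); rewrite piE /Quotient.equiv.
move=> /asboolP h.
have F : Filter (nbhs (almost_everywhere leb)) by apply: ae_filter_ringOfSetsType.
by apply: (filterS _ h) => x hx Ix; apply: subr0_eq; exact: (hx Ix).
Qed.

Lemma represents_inj u (f g : L2) : represents u f -> represents u g -> f = g.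
Proof.
move=> hf hg; rewrite -[f]reprK -[g]reprK; apply/eqP.
rewrite piE /Quotient.equiv; apply/asboolP.
have F : Filter (nbhs (almost_everywhere leb)) by apply: ae_filter_ringOfSetsType.
apply: (filterS2 _ _ hf hg) => x hfx hgx Ix.
change (L2repr f x - L2repr g x = 0).
by rewrite hfx// hgx// subrr.
Qed.

(* u is the continuous representative on [0, 2 pi] of an element of
   H^1(0, 2 pi), that is u is absolutely continuous (the indefinite integral
   of an integrable function) and its almost everywhere derivative du is in
   L^2; the boundary values u 0 and u twopi are those of this representative.
   The values of u outside [0, 2 pi] are irrelevant. *)
Definition is_H1 (u du : R -> R[i]) : Prop :=
  is_L2 du /\
  forall x : R, 0 <= x <= twopi -> u x = u 0 + cintegral `[0, x] du.

Variable V : R -> R[i].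

Definition Amin : graph L2 :=
  [set p | exists u du : R -> R[i],
    [/\ is_H1 u du, u 0 = 0 /\ u twopi = 0, represents u p.1 &
        represents (fun x => 'i%C * du x + V x * u x) p.2]].

Definition Aop (rho : R[i]) (k : L2) : graph L2 :=
  [set p | exists u du : R -> R[i],
    [/\ is_H1 u du, u 0 = rho * u twopi, represents u p.1 &
        represents
          (fun x => 'i%C * du x + V x * u x + u twopi * L2repr k x) p.2]].

Definition maxdiss_extension (rho : R[i]) (k : L2) : Prop :=
  Amin `<=` Aop rho k /\ maximally_dissipative ip2 (Aop rho k).

End L2Operators.

(* Main.v *)
Require Import Defs.
From mathcomp Require Import all_boot all_order all_algebra.
From mathcomp Require Import complex.
From mathcomp Require Import all_classical all_reals all_analysis measurable_realfun.
From mathcomp Require Import lra ring.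

(* Write E = exp(i int_0^x (V - lam)) and F = exp(i int_0^x (conj V - lam)), so that
   conj F * E = 1.  Since Im <f, Af> >= 0 on dom A and this form vanishes at
   an eigenvector f with real eigenvalue lam, its first variation at f vanishes:
   f is orthogonal to the range of A - lam.  Hence root vectors for lam are
   eigenvectors, and f is orthogonal to all other root spaces.  Testing
   against (A - lam)(E W) = i E W', where W vanishes at both ends, gives
   f = c F: the eigenspace is spanned by F, and inserting F in the boundary
   condition and the equation yields rho = 1 / F(2 pi) and
   k = - 2 i (Im V) F / F(2 pi).  So lam determines (rho, k); and two real
   eigenvalues lam, mu of the same A force exp(i (mu - lam) x) = 1 on the set
   {Im V > 0}, which is not countable.  Finally a point of the spectrum is an
   eigenvalue, because variation of constants solves (A - lam) f = h
   with a bound unless a scalar characteristic coefficient vanishes, in which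
   case it produces an eigenvector. *)

Set Implicit Arguments.
Unset Strict Implicit.
Unset Printing Implicit Defensive.
Import Order.TTheory GRing.Theory Num.Theory.
Import numFieldNormedType.Exports.
Local Open Scope classical_set_scope.
Local Open Scope complex_scope.
Local Open Scope quotient_scope.
Local Open Scope ring_scope.

Local Notation Re := complex.Re.
Local Notation Im := complex.Im.

(** * Absolutely continuous functions *)

Section AbsolutelyContinuous.
Context {R : realType}.
Local Notation leb := (@lebesgue_measure R).
Implicit Types f g : R -> R.

(** Absolute continuity is used in integral form only: [u] comes with a chosen [du], and no
    pointwise derivative of [u] is taken. The calculus needed for E, F and E W is therefore derived
    from increments: over [[r, s]] the increment of a product or of a composite differs from the
    integral of the expected derivative by at most C (s - r) (Psi s - Psi r), and such errors
    disappear under subdivision. The estimate asks for one bounded derivative, so [V] is first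
    replaced by a representative [V'] bounded everywhere; E and F then have bounded derivatives, and
    merely square integrable data enter through the other factor. A second difficulty is the value
    u(2 pi) in [Aop], which an L^2 class does not see. It is recovered from the continuity of the
    representative, and in the resolvent it becomes an unknown number [b]: the nonlocal equation
    splits into an initial value problem and one scalar equation for [b]. *)

Definition Rintegrable (D : set R) (f : R -> R) := leb.-integrable D (EFin \o f).

Lemma RintegrableS (E D : set R) f : measurable E -> measurable D -> D `<=` E ->
  Rintegrable E f -> Rintegrable D f.
Proof. by move=> mE mD ED; exact: integrableS. Qed.

Lemma Rintegrable_meas (D : set R) f : Rintegrable D f -> measurable_fun D f.
Proof. by move=> /measurable_int /measurable_EFinP. Qed.

Lemma RintegrableD (D : set R) f g : measurable D -> Rintegrable D f ->
  Rintegrable D g ->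
  Rintegrable D (fun x => f x + g x).
Proof. by move=> mD; exact: integrableD. Qed.

Lemma RintegrableB (D : set R) f g : measurable D -> Rintegrable D f ->
  Rintegrable D g ->
  Rintegrable D (fun x => f x - g x).
Proof. by move=> mD; exact: integrableB. Qed.

Lemma RintegrableZl (D : set R) k f : measurable D -> Rintegrable D f ->
  Rintegrable D (fun x => k * f x).
Proof. by move=> mD; exact: integrableZl. Qed.

Lemma Rintegrable_abs (D : set R) f : measurable D -> Rintegrable D f ->
  Rintegrable D (fun x => `|f x|).
Proof. by move=> mD; exact: integrable_norm. Qed.

Lemma le_Rintegrable (D : set R) f g : measurable D -> measurable_fun D f ->
  (forall x, D x -> `|f x| <= `|g x|) -> Rintegrable D g -> Rintegrable D f.
Proof.
move=> mD mf fg; apply: le_integrable => //; first exact/measurable_EFinP.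
Qed.

Lemma RintegrableM_bounded (D : set R) f g M : measurable D -> measurable_fun D f ->
  (forall x, D x -> `|f x| <= M) -> Rintegrable D g ->
    Rintegrable D (fun x => f x * g x).
Proof.
move=> mD mf fM ig; apply: (@le_Rintegrable _ _ (fun x => M * g x)) => //.
- by apply: measurable_funM => //; exact: Rintegrable_meas.
- move=> x Dx; rewrite !normrM ler_wpM2r//.
  exact: le_trans (fM _ Dx) (ler_norm _).
- exact: RintegrableZl.
Qed.

Lemma Rintegrable_cst_itv b1 b2 (a b : R) (c : R) :
  Rintegrable [set` Interval (BSide b1 a) (BSide b2 b)] (fun=> c).
Proof.
apply: measurable_bounded_integrable => //.
  have : (leb [set` Interval (BSide b1 a) (BSide b2 b)] < +oo)%E.
    by rewrite lebesgue_measure_itv /=; case: ifP => //= _; exact: ltry.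
  by [].
exists `|c|; split; first exact: num_real.
by move=> y cy x _ /=; exact: ltW.
Qed.

Lemma Rintegral_itv_cst (a b c : R) : a <= b ->
  \int[leb]_(_ in `]a, b]) c = c * (b - a).
Proof.
move=> ab; transitivity (c * fine (leb `]a, b])); first exact: Rintegral_cst.
rewrite lebesgue_measure_itv/= lte_fin; by case: ltgtP ab => //= -> _; rewrite subrr.
Qed.

Lemma bounded_Rintegrable (a b : R) f M : measurable_fun `[a, b] f ->
  (forall x, x \in `[a, b] -> `|f x| <= M) -> Rintegrable `[a, b] f.
Proof.
move=> mf fM; apply: (@le_Rintegrable _ _ (fun=> M)) => //.
- by move=> x /fM /le_trans; apply; exact: ler_norm.
- exact: Rintegrable_cst_itv.
Qed.

(* Sum the hypothesis over a uniform partition of [0, x] into n pieces: the total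
   is O(1/n). *)
Lemma second_order_cst (T C : R) (D Psi : R -> R) :
  (forall r s, 0 <= r -> r <= s -> s <= T ->
    `|D s - D r| <= C * (s - r) * (Psi s - Psi r)) ->
  forall x, 0 <= x <= T -> D x = D 0.
Proof.
move=> H x /andP[x0 xT].
have step (n : nat) : `|D x - D 0| <= (C * x * (Psi x - Psi 0)) / n.+1%:R.
  have n0 : (n.+1%:R : R) != 0 by rewrite pnatr_eq0.
  pose p (i : nat) : R := i%:R * (x / n.+1%:R).
  have pS i : p i.+1 - p i = x / n.+1%:R by rewrite /p -mulrBl -natrB// subSnn mul1r.
  have pn : p n.+1 = x by rewrite /p mulrC divfK.
  have p0 : p 0%N = 0 by rewrite /p mul0r.
  have xn0 : 0 <= x / n.+1%:R by rewrite divr_ge0.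
  have H' (m : nat) : (m <= n.+1)%N ->
      `|D (p m) - D 0| <= C * (x / n.+1%:R) * (Psi (p m) - Psi 0).
    elim: m => [|m IH] mn; first by rewrite p0 !subrr normr0 mulr0.
    have -> : D (p m.+1) - D 0 = (D (p m.+1) - D (p m)) + (D (p m) - D 0) by ring.
    have -> : C * (x / n.+1%:R) * (Psi (p m.+1) - Psi 0) =
      C * (p m.+1 - p m) * (Psi (p m.+1) - Psi (p m)) +
      C * (x / n.+1%:R) * (Psi (p m) - Psi 0) by rewrite pS; ring.
    apply: le_trans (ler_normD _ _) _; apply: lerD; last by apply: IH; exact: ltnW.
    apply: H; first by rewrite mulr_ge0.
      by rewrite -subr_ge0 pS.
    apply: le_trans xT; rewrite -[leRHS]pn /p ler_wpM2r// ler_nat//.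
  have := H' n.+1 (leqnn _); rewrite pn => /le_trans; apply.
  by rewrite le_eqVlt; apply/orP; left; apply/eqP; field; rewrite addrC natr1.
apply/eqP; rewrite -subr_eq0 -normr_le0; apply/ler_addgt0Pl => e e0.
rewrite addr0.
set K := C * x * (Psi x - Psi 0) in step.
have [n Hn] : exists n, `|K| / e < n.+1%:R.
  exists (Num.truncn (`|K| / e)); rewrite truncnS_gt// .
apply: le_trans (step n) _; rewrite ler_pdivrMr ?ltr0Sn//.
apply: le_trans (ler_norm _) _; rewrite mulrC -ler_pdivrMr//; exact: ltW.
Qed.

Definition abscont (T : R) (u du : R -> R) :=
  Rintegrable `[0, T] du /\
  forall x, 0 <= x <= T -> u x = u 0 + \int[leb]_(t in `[0, x]) du t.

Section ACTheory.
Variable T : R.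
Implicit Types u v du dv : R -> R.

Let sub_oc (r s : R) : 0 <= r -> s <= T -> `]r, s] `<=` `[0, T].
Proof.
move=> r0 sT x /=; rewrite !in_itv/= => /andP[rx xs].
by rewrite (le_trans r0 (ltW rx)) (le_trans xs sT).
Qed.

Let sub_cc (s : R) : s <= T -> `[0, s] `<=` `[0, T].
Proof.
move=> sT x /=; rewrite !in_itv/= => /andP[-> xs].
by rewrite (le_trans xs sT).
Qed.

Lemma Rintegral_itv_diff f r s : Rintegrable `[0, T] f -> 0 <= r -> r <= s -> s <= T ->
  \int[leb]_(t in `[0, s]) f t - \int[leb]_(t in `[0, r]) f t =
  \int[leb]_(t in `]r, s]) f t.
Proof.
move=> fi r0 rs sT; rewrite Rintegral_itvB// ?bnd_simp//.
by apply: RintegrableS fi => //; exact: sub_cc.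
Qed.

Lemma abscont_diff u du r s : abscont T u du -> 0 <= r -> r <= s -> s <= T ->
  u s - u r = \int[leb]_(t in `]r, s]) du t.
Proof.
move=> [di H] r0 rs sT; rewrite -Rintegral_itv_diff//.
by rewrite (H s) ?(H r) ?r0 ?sT ?(le_trans r0 rs) ?(le_trans rs sT)//; ring.
Qed.

Lemma le_normr_Rintegral_itv f g r s : Rintegrable `]r, s] f -> Rintegrable `]r, s] g ->
  (forall t, t \in `]r, s] -> `|f t| <= g t) ->
  `|\int[leb]_(t in `]r, s]) f t| <= \int[leb]_(t in `]r, s]) g t.
Proof.
move=> fi gi fg; apply: le_trans (le_normr_Rintegral _ fi) _ => //.
by apply: le_Rintegral => //; exact: Rintegrable_abs.
Qed.

Lemma abscont_lipschitz u du L r s : abscont T u du ->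
  (forall t, t \in `[0, T] -> `|du t| <= L) -> 0 <= r -> r <= s -> s <= T ->
  `|u s - u r| <= L * (s - r).
Proof.
move=> ac dL r0 rs sT; rewrite (abscont_diff ac)// -Rintegral_itv_cst//.
apply: le_normr_Rintegral_itv.
- by apply: RintegrableS ac.1 => //; exact: sub_oc.
- exact: Rintegrable_cst_itv.
- by move=> t /(sub_oc r0 sT); exact: dL.
Qed.

(** The bound is taken over the larger interval from [r] to [s], so that it does not depend on [t]
    and acts as a constant under the integral in the product rule. *)
Lemma abscont_variation v dv r t s : abscont T v dv -> 0 <= r -> r <= t -> t <= s ->
  s <= T ->
  `|v s - v t| <= \int[leb]_(x in `[0, s]) `|dv x| - \int[leb]_(x in `[0, r]) `|dv x|.
Proof.
move=> ac r0 rt ts sT.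
have ai : Rintegrable `[0, T] (fun x => `|dv x|) by apply: Rintegrable_abs ac.1.
have t0 := le_trans r0 rt.
have tT := le_trans ts sT.
apply: (@le_trans _ _ (\int[leb]_(x in `[0, s]) `|dv x| - \int[leb]_(x in `[0,
  t]) `|dv x|)).
  rewrite (abscont_diff ac)// Rintegral_itv_diff//; apply: le_normr_Rintegral => //.
  by apply: RintegrableS ac.1 => //; exact: sub_oc.
rewrite lerD2l lerN2 -subr_ge0 Rintegral_itv_diff//.
exact: Rintegral_ge0.
Qed.

Lemma abscont_meas u du : 0 <= T -> abscont T u du -> measurable_fun `[0, T] u.
Proof.
move=> T0 [di H].
have c := parameterized_integral_continuous T0 di.
have m : measurable_fun `[0, T] (fun x => u 0 + parameterized_integral leb 0 x du).
  apply: measurable_funD => //.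
  exact: (subspace_continuous_measurable_fun _ c).
apply: eq_measurable_fun m => x; rewrite inE/= in_itv/= => xT.
by rewrite (H x xT).
Qed.

Lemma abscont_bounded u du : abscont T u du -> exists M, forall x, x \in `[0, T] ->
  `|u x| <= M.
Proof.
move=> ac; exists (`|u 0| + (\int[leb]_(x in `[0, T]) `|du x| - \int[leb]_(x in `[0,
  0]) `|du x|)).
move=> x; rewrite /= in_itv/= => /andP[x0 xT].
rewrite -{1}(subrK (u 0) (u x)) addrC; apply: le_trans (ler_normD _ _) _.
rewrite lerD2l; apply: le_trans (abscont_variation ac (lexx _) (lexx _) x0 xT) _.
have ai : Rintegrable `[0, T] (fun x => `|du x|) by apply: Rintegrable_abs ac.1.
rewrite lerD2r -subr_ge0 Rintegral_itv_diff//.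
exact: Rintegral_ge0.
Qed.

Lemma abscont_sub u du v dv : abscont T u du -> abscont T v dv ->
  abscont T (fun x => u x - v x) (fun x => du x - dv x).
Proof.
move=> [di H] [vi K]; split; first exact: RintegrableB.
move=> x xT; have /andP[_ xT'] := xT.
rewrite RintegralB//; first by rewrite (H x xT) (K x xT); ring.
  by apply: RintegrableS di => //; exact: sub_cc.
by apply: RintegrableS vi => //; exact: sub_cc.
Qed.

Lemma abscont_add u du v dv : abscont T u du -> abscont T v dv ->
  abscont T (fun x => u x + v x) (fun x => du x + dv x).
Proof.
move=> [di H] [vi K]; split; first exact: RintegrableD.
move=> x xT; have /andP[_ xT'] := xT.
rewrite RintegralD//; first by rewrite (H x xT) (K x xT); ring.
  by apply: RintegrableS di => //; exact: sub_cc.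
by apply: RintegrableS vi => //; exact: sub_cc.
Qed.

(** Subtracting the primitive of [du] from [u] leaves a function whose increments are of second
    order, hence a constant. *)
Lemma abscont_second_order u du C (Psi : R -> R) : Rintegrable `[0, T] du ->
  (forall r s, 0 <= r -> r <= s -> s <= T ->
   `|u s - u r - \int[leb]_(t in `]r, s]) du t| <= C * (s - r) * (Psi s - Psi r)) ->
  abscont T u du.
Proof.
move=> di H; split=> // x xT.
pose D x := u x - \int[leb]_(t in `[0, x]) du t.
have : D x = D 0.
  apply: (@second_order_cst T C D Psi) => // r s r0 rs sT; rewrite /D.
  rewrite (_ : _ - _ = u s - u r - \int[leb]_(t in `]r, s]) du t); first exact: H.
  by rewrite -Rintegral_itv_diff//; ring.
rewrite /D set_itv1 Rintegral_set1 subr0 => <-; ring.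
Qed.

(** The derivative of [u] is bounded, that of [v] only integrable, so [Psi] is the variation
    function of [v]. Two error terms arise, each at most L (s - r) (Psi s - Psi r), whence the
    constant [2 * L]. *)
Lemma abscont_mul u du v dv L : 0 <= T -> abscont T u du -> abscont T v dv ->
  (forall t, t \in `[0, T] -> `|du t| <= L) ->
  abscont T (fun x => u x * v x) (fun x => du x * v x + u x * dv x).
Proof.
move=> T0 au av dL.
have [M uM] := abscont_bounded au; have [N vN] := abscont_bounded av.
have mu := abscont_meas T0 au; have mv := abscont_meas T0 av.
have i1 : Rintegrable `[0, T] (fun x => du x * v x).
  have : Rintegrable `[0, T] (fun x => v x * du x) by apply: (RintegrableM_bounded _ mv
    vN) => //; exact: au.1.
  by apply: eq_integrable => // x _ /=; rewrite mulrC.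
have i2 : Rintegrable `[0, T] (fun x => u x * dv x).
  by apply: (RintegrableM_bounded _ mu uM) => //; exact: av.1.
have i12 := RintegrableD (measurable_itv _) i1 i2.
apply: (@abscont_second_order _ _ (2 * L) (fun s => \int[leb]_(x in `[0,
  s]) `|dv x|)) => //.
move=> r s r0 rs sT.
set P := \int[leb]_(x in `[0, s]) `|dv x| - \int[leb]_(x in `[0, r]) `|dv x|.
have rsub f : Rintegrable `[0, T] f -> Rintegrable `]r, s] f.
  by move=> fi; apply: RintegrableS fi => //; exact: sub_oc.
have s0 := le_trans r0 rs; have rT := le_trans rs sT.
(* The increment is split as v(s) (u(s) - u(r)) + u(r) (v(s) - v(r)): with one factor frozen, each
   difference is the integral of a derivative. *)
have -> : u s * v s - u r * v r - \int[leb]_(t in `]r, s]) (du t * v t + u t * dv t)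
  = \int[leb]_(t in `]r, s]) ((du t * v s + u r * dv t) - (du t * v t + u t * dv t)).
  rewrite RintegralB//; last 2 first.
  - apply: RintegrableD => //; last by apply/RintegrableZl/rsub => //; exact: av.1.
    have : Rintegrable `]r, s] (fun t => v s * du t) by apply/RintegrableZl/rsub => //;
      exact: au.1.
    by apply: eq_integrable => // x _ /=; rewrite mulrC.
  - exact: rsub.
  congr (_ - _); rewrite RintegralD//; last 2 first.
  - have : Rintegrable `]r, s] (fun t => v s * du t) by apply/RintegrableZl/rsub => //;
    exact: au.1.
    by apply: eq_integrable => // x _ /=; rewrite mulrC.
  - by apply/RintegrableZl/rsub => //; exact: av.1.
  rewrite RintegralZr//; last exact/rsub/au.1.
  rewrite RintegralZl//; last exact/rsub/av.1.
  rewrite -(abscont_diff au)// -(abscont_diff av)//; ring.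
have iabs : Rintegrable `]r, s] (fun t => `|dv t|) by apply/rsub/Rintegrable_abs => //;
  exact: av.1.
have L0 : 0 <= L by apply: le_trans (dL 0 _) => //=; rewrite in_itv/= lexx.
have -> : 2 * L * (s - r) * P = \int[leb]_(t in `]r,
  s]) (L * P + (L * (s - r)) * `|dv t|).
  rewrite RintegralD//; last 2 first.
  - exact: Rintegrable_cst_itv.
  - exact: RintegrableZl.
  rewrite Rintegral_itv_cst// RintegralZl//.
  rewrite -(@Rintegral_itv_diff (fun t => `|dv t|)) //;
    last by apply: Rintegrable_abs av.1.
  by rewrite -/P; ring.
apply: le_normr_Rintegral_itv.
- apply: RintegrableB => //; last exact: rsub.
  apply: RintegrableD => //; last by apply/RintegrableZl/rsub => //; exact: av.1.
  have : Rintegrable `]r, s] (fun t => v s * du t) by apply/RintegrableZl/rsub => //;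
    exact: au.1.
  by apply: eq_integrable => // x _ /=; rewrite mulrC.
- by apply: RintegrableD => //; [exact: Rintegrable_cst_itv|exact: RintegrableZl].
- move=> t; rewrite /= in_itv/= => /andP[rt ts].
  have -> : du t * v s + u r * dv t - (du t * v t + u t * dv t) =
    du t * (v s - v t) + (u r - u t) * dv t by ring.
  have tT : t \in `[0, T] by rewrite /= in_itv/= (le_trans r0 (ltW rt)) (le_trans ts
    sT).
  apply: le_trans (ler_normD _ _) _; rewrite !normrM; apply: lerD.
    apply: ler_pM => //; first exact: dL.
    by apply: abscont_variation av _ (ltW rt) _ _.
  apply: ler_wpM2r => //; rewrite distrC.
  apply: le_trans (abscont_lipschitz au dL r0 (ltW rt) (le_trans ts sT)) _.
  by rewrite ler_wpM2l// lerD2r.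
Qed.

(** Second-order Taylor expansion of [G] at u(r) leaves K (L (s - r))^2. Replacing dG(u(t)) by
    dG(u(r)) under the integral costs as much again, by the Lipschitz bound on [dG]; hence
    [2 * K * L ^+ 2], with the identity as [Psi]. *)
Lemma abscont_comp u du L B K (G dG ddG : R -> R) : 0 <= T -> abscont T u du ->
  (forall t, t \in `[0, T] -> `|du t| <= L) ->
  (forall t, t \in `[0, T] -> `|u t| <= B) ->
  (forall x : R, is_derive x 1 G (dG x)) ->
  (forall x : R, is_derive x 1 dG (ddG x)) ->
  (forall x, `|x| <= B -> `|ddG x| <= K) ->
  abscont T (fun x => G (u x)) (fun x => dG (u x) * du x).
Proof.
move=> T0 au dL uB dG1 dG2 ddK.
have cont (f df : R -> R) : (forall x : R, is_derive x 1 f (df x)) -> continuous f.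
  by move=> h x; apply/differentiable_continuous/derivable1_diffP; have [] := h x.
(* The intermediate point stays in [-B, B], where the bound on [ddG] applies, and within |b - a| of
   [a], which makes the Taylor remainder quadratic. *)
have mvt (f df : R -> R) : (forall x : R, is_derive x 1 f (df x)) ->
    forall a b, `|a| <= B -> `|b| <= B -> exists c,
      [/\ `|c| <= B, `|c - a| <= `|b - a| & f b - f a = df c * (b - a)].
  move=> h a b aB bB; have cf := cont _ _ h; have [ab|/ltW ba] := leP a b.
    have [c] := @MVT_segment _ f df a b ab (fun x _ => h x) (continuous_subspaceT cf).
    rewrite in_itv/= => /andP[ac cb] e; exists c; split=> //.
      move: aB bB; rewrite !ler_norml => /andP[a1 a2] /andP[b1 b2]; apply/andP; split;
        lra.
    rewrite !ger0_norm ?subr_ge0//; lra.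
  have [c] := @MVT_segment _ f df b a ba (fun x _ => h x) (continuous_subspaceT cf).
  rewrite in_itv/= => /andP[bc ca] e; exists c; split=> //.
    move: aB bB; rewrite !ler_norml => /andP[a1 a2] /andP[b1 b2]; apply/andP; split;
      lra.
    rewrite !ler0_norm ?subr_le0//; lra.
  by rewrite -opprB e; ring.
have lip a b : `|a| <= B -> `|b| <= B -> `|dG b - dG a| <= K * `|b - a|.
  move=> aB bB; have [c [cB _ ->]] := mvt _ _ dG2 a b aB bB.
  by rewrite normrM ler_wpM2r// ddK.
have K0 : 0 <= K.
  apply: le_trans (ddK (u 0) _) => //; apply: uB => /=; by rewrite in_itv/= lexx.
have taylor a b : `|a| <= B -> `|b| <= B ->
    `|G b - G a - dG a * (b - a)| <= K * `|b - a| ^+ 2.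
  move=> aB bB; have [c [cB ca ->]] := mvt _ _ dG1 a b aB bB.
  rewrite -mulrBl normrM expr2 mulrA ler_wpM2r//.
  by apply: le_trans (lip _ _ aB cB) _; rewrite ler_wpM2l.
have mu := abscont_meas T0 au.
have mdG f df : (forall x : R, is_derive x 1 f (df x)) ->
    measurable_fun `[0, T] (fun x => f (u x)).
  move=> h; apply: measurableT_comp mu.
  by apply: continuous_measurable_fun; exact: cont h.
have L0 : 0 <= L by apply: le_trans (dL 0 _) => //=; rewrite in_itv/= lexx.
have i1 : Rintegrable `[0, T] (fun x => dG (u x) * du x).
  have u0T : 0 \in `[0, T] by rewrite /= in_itv/= lexx.
  (* [dG] is K-Lipschitz on [-B, B], and u(x) lies within B + B of u(0). *)
  apply: (@RintegrableM_bounded _ _ _ (`|dG (u 0)| + K * (B + B))) => //;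
    last exact: au.1.
    exact: mdG dG2.
  move=> x xT; rewrite -(subrK (dG (u 0)) (dG (u x))) addrC.
  apply: le_trans (ler_normD _ _) _; rewrite lerD2l.
  apply: le_trans (lip _ _ (uB _ u0T) (uB _ xT)) _; rewrite ler_wpM2l//.
  by apply: le_trans (ler_normB _ _) _; rewrite lerD// uB.
apply: (@abscont_second_order _ _ (2 * K * L ^+ 2) id) => // r s r0 rs sT.
have rsub f : Rintegrable `[0, T] f -> Rintegrable `]r, s] f.
  by move=> fi; apply: RintegrableS fi => //; exact: sub_oc.
have s0 := le_trans r0 rs; have rT := le_trans rs sT.
have rI : r \in `[0, T] by rewrite /= in_itv/= r0.
have sI : s \in `[0, T] by rewrite /= in_itv/= s0.
have duI := rsub _ au.1.
have -> : G (u s) - G (u r) - \int[leb]_(t in `]r, s]) (dG (u t) * du t) =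
  (G (u s) - G (u r) - dG (u r) * (u s - u r)) -
  \int[leb]_(t in `]r, s]) (dG (u t) * du t - dG (u r) * du t).
  rewrite RintegralB//; last 2 first.
  - exact: rsub.
  - exact: RintegrableZl.
  by rewrite RintegralZl// -(abscont_diff au)//; ring.
have lipu := abscont_lipschitz au dL.
have -> : 2 * K * L ^+ 2 * (s - r) * (s - r) =
  K * (L * (s - r)) ^+ 2 + (K * L * L * (s - r)) * (s - r) by ring.
apply: le_trans (ler_normB _ _) _; apply: lerD.
  apply: le_trans (taylor _ _ (uB _ rI) (uB _ sI)) _.
  by rewrite ler_wpM2l// lerXn2r// ?nnegrE ?mulr_ge0 ?subr_ge0//; exact: lipu.
rewrite -Rintegral_itv_cst//; apply: le_normr_Rintegral_itv.
- by apply: RintegrableB => //; [exact: rsub|exact: RintegrableZl].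
- exact: Rintegrable_cst_itv.
- move=> t tI; have tT := sub_oc r0 sT tI.
  move: tI; rewrite /= in_itv/= => /andP[rt ts].
  rewrite -mulrBl normrM.
  have -> : K * L * L * (s - r) = (K * (L * (s - r))) * L by ring.
  apply: ler_pM => //; last exact: dL.
  apply: le_trans (lip _ _ (uB _ rI) (uB _ tT)) _; rewrite ler_wpM2l//.
  apply: le_trans (lipu _ _ r0 (ltW rt) (le_trans ts sT)) _.
  by rewrite ler_wpM2l// lerD2r.
Qed.

End ACTheory.
End AbsolutelyContinuous.

(** * Complex-valued functions and the exponential of a primitive *)

Section ComplexParts.
Context {R : realType}.
Implicit Types z w : R[i].

Lemma complex_ext z w : Re z = Re w -> Im z = Im w -> z = w.
Proof. by case: z w => [a b] [c d] /= -> ->. Qed.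

Lemma ReM z w : Re (z * w) = Re z * Re w - Im z * Im w.
Proof. by case: z w => [a b] [c d]. Qed.

Lemma ImM z w : Im (z * w) = Re z * Im w + Im z * Re w.
Proof. by case: z w => [a b] [c d]. Qed.

Lemma ReD z w : Re (z + w) = Re z + Re w.
Proof. by case: z w => [a b] [c d]. Qed.

Lemma ImD z w : Im (z + w) = Im z + Im w.
Proof. by case: z w => [a b] [c d]. Qed.

Lemma ReN z : Re (- z) = - Re z.
Proof. by case: z. Qed.

Lemma ImN z : Im (- z) = - Im z.
Proof. by case: z. Qed.

Lemma ReJ z : Re (conjc z) = Re z.
Proof. by case: z. Qed.

Lemma ImJ z : Im (conjc z) = - Im z.
Proof. by case: z. Qed.

Definition partsE := (ReM, ImM, ReD, ImD, ReN, ImN, ReJ, ImJ).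

Lemma sqmodM z w : sqmod (z * w) = sqmod z * sqmod w.
Proof. by rewrite !sqmodE !partsE; ring. Qed.

Lemma sqmodJ z : sqmod (conjc z) = sqmod z.
Proof. by rewrite !sqmodE !partsE; ring. Qed.

Lemma conjcM z w : conjc (z * w) = conjc z * conjc w.
Proof. by case: z w => [a b] [c d]; apply: complex_ext => /=; ring. Qed.

Lemma sqmod0 : sqmod (0 : R[i]) = 0.
Proof. by rewrite sqmodE /= expr0n /= addr0. Qed.

Lemma sqmod_eq0 z : sqmod z = 0 -> z = 0.
Proof.
rewrite sqmodE => /eqP; rewrite paddr_eq0 ?sqr_ge0// !sqrf_eq0 => /andP[/eqP a /eqP b].
exact: complex_ext.
Qed.

Lemma sqr_i2 : 'i%C * 'i%C = -1 :> R[i].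
Proof. by rewrite -expr2 sqr_i. Qed.

End ComplexParts.

Section ComplexMeasurable.
Context {R : realType}.
Implicit Types (D : set R) (u v : R -> R[i]).

Lemma cmeasurableM D u v : cmeasurable D u -> cmeasurable D v ->
  cmeasurable D (fun x => u x * v x).
Proof.
move=> [u1 u2] [v1 v2]; split; under eq_fun do rewrite partsE.
  by apply: measurable_funB; apply: measurable_funM.
by apply: measurable_funD; apply: measurable_funM.
Qed.

Lemma cmeasurableD D u v : cmeasurable D u -> cmeasurable D v ->
  cmeasurable D (fun x => u x + v x).
Proof.
by move=> [u1 u2] [v1 v2]; split; under eq_fun do rewrite partsE;
  apply: measurable_funD.
Qed.

Lemma cmeasurableJ D u : cmeasurable D u -> cmeasurable D (fun x => conjc (u x)).
Proof.
move=> [u1 u2]; split; under eq_fun do rewrite partsE; first by [].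
exact: measurable_funN.
Qed.

Lemma cmeasurable_cst D (c : R[i]) : cmeasurable D (fun=> c).
Proof. by split; exact: measurable_cst. Qed.

Lemma cmeasurableS D E u : measurable E -> D `<=` E ->
  cmeasurable E u -> cmeasurable D u.
Proof. by move=> mE DE [m1 m2]; split; apply: measurable_funS DE _. Qed.

Definition cbounded D u :=
  exists M, forall x, D x -> `|Re (u x)| <= M /\ `|Im (u x)| <= M.

Lemma cboundedM D u v : cbounded D u -> cbounded D v ->
  cbounded D (fun x => u x * v x).
Proof.
move=> [M HM] [N HN]; exists (2 * (M * N)) => x Dx.
have [a1 a2] := HM x Dx; have [b1 b2] := HN x Dx.
have P (a b : R) : `|a| <= M -> `|b| <= N -> `|a * b| <= M * N.
  by move=> aM bN; rewrite normrM ler_pM.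
rewrite !partsE; split.
  by apply: le_trans (ler_normB _ _) _; rewrite mulr_natl mulr2n lerD// P.
by apply: le_trans (ler_normD _ _) _; rewrite mulr_natl mulr2n lerD// P.
Qed.

Lemma cboundedD D u v : cbounded D u -> cbounded D v ->
  cbounded D (fun x => u x + v x).
Proof.
move=> [M HM] [N HN]; exists (M + N) => x Dx.
have [a1 a2] := HM x Dx; have [b1 b2] := HN x Dx.
by rewrite !partsE; split; apply: le_trans (ler_normD _ _) _; rewrite lerD.
Qed.

Lemma cboundedJ D u : cbounded D u -> cbounded D (fun x => conjc (u x)).
Proof.
by move=> [M HM]; exists M => x Dx; rewrite !partsE normrN; exact: HM.
Qed.

Lemma cbounded_cst D (c : R[i]) : cbounded D (fun=> c).
Proof.
by exists (`|Re c| + `|Im c|) => x _; split; [rewrite lerDl|rewrite lerDr].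
Qed.

Lemma cboundedS D E u : D `<=` E -> cbounded E u -> cbounded D u.
Proof. by move=> DE [M H]; exists M => x /DE; exact: H. Qed.

Lemma cbounded_sqmod D u : cbounded D u -> exists2 M, 0 <= M & forall x, D x ->
  sqmod (u x) <= M.
Proof.
move=> [M HM]; exists (M ^+ 2 + M ^+ 2); first by rewrite addr_ge0// sqr_ge0.
move=> x /HM[a b]; rewrite sqmodE -real_normK ?num_real// -[X in _ + X]real_normK
  ?num_real//.
by rewrite lerD// lerXn2r// nnegrE// (le_trans _ a).
Qed.

Definition cintegrable D u := Rintegrable D (fun x => Re (u x)) /\ Rintegrable D (fun x
  => Im (u x)).

Lemma cintegrableZ D (c : R[i]) u : measurable D -> cintegrable D u ->
  cintegrable D (fun x => c * u x).
Proof.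
move=> mD [a b]; split; under eq_fun do rewrite partsE.
  by apply: RintegrableB => //; exact: RintegrableZl.
by apply: RintegrableD => //; exact: RintegrableZl.
Qed.

Lemma cintegralD D u v : measurable D -> cintegrable D u -> cintegrable D v ->
  cintegral D (fun x => u x + v x) = cintegral D u + cintegral D v.
Proof.
move=> mD [a b] [c d]; apply: complex_ext; rewrite ?ReD ?ImD /=.
  by rewrite -RintegralD//; apply: eq_Rintegral => x _; rewrite /= partsE.
by rewrite -RintegralD//; apply: eq_Rintegral => x _; rewrite /= partsE.
Qed.

Lemma cintegralZ D (c : R[i]) u : measurable D -> cintegrable D u ->
  cintegral D (fun x => c * u x) = c * cintegral D u.
Proof.
move=> mD [a b]; apply: complex_ext; rewrite ?ReM ?ImM /=.
  rewrite -!RintegralZl// -RintegralB//; try exact: RintegrableZl.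
  by apply: eq_Rintegral => x _; rewrite /= partsE.
rewrite -!RintegralZl// -RintegralD//; try exact: RintegrableZl.
by apply: eq_Rintegral => x _; rewrite /= partsE.
Qed.

Lemma cintegralJ D u : measurable D -> cintegrable D u ->
  cintegral D (fun x => conjc (u x)) = conjc (cintegral D u).
Proof.
move=> mD [a b]; apply: complex_ext; rewrite /= ?partsE /=.
  by apply: eq_Rintegral => x _; rewrite /= partsE.
rewrite -mulN1r -RintegralZl//.
by apply: eq_Rintegral => x _; rewrite /= partsE mulN1r.
Qed.

Lemma eq_cintegral D u v : (forall x, D x -> u x = v x) ->
  cintegral D u = cintegral D v.
Proof.
by move=> uv; congr (_ +i* _); apply: eq_Rintegral => x; rewrite inE => /uv ->.
Qed.

Lemma ae_eq_cintegral D u v : measurable D -> cmeasurable D u -> cmeasurable D v ->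
  ae_eq (@lebesgue_measure R) D u v -> cintegral D u = cintegral D v.
Proof.
move=> mD [u1 u2] [v1 v2] uv; congr (_ +i* _); rewrite /Rintegral; congr fine;
  apply: ae_eq_integral => //; try exact/measurable_EFinP.
- exact: (@ae_eq_comp _ _ _ _ _ _ _ (fun z : R[i] => (Re z)%:E : \bar R)).
- exact: (@ae_eq_comp _ _ _ _ _ _ _ (fun z : R[i] => (Im z)%:E : \bar R)).
Qed.

End ComplexMeasurable.

(** * Complex absolutely continuous functions and exponentials of primitives *)

Section ComplexAC.
Context {R : realType}.
Variable T : R.
Hypothesis T0 : 0 <= T.
Implicit Types (u v w y : R -> R[i]).

Definition cabscont u du :=
  abscont T (fun x => Re (u x)) (fun x => Re (du x)) /\
  abscont T (fun x => Im (u x)) (fun x => Im (du x)).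

Lemma cabscontE u du : cabscont u du <->
  cintegrable `[0, T] du /\ forall x, 0 <= x <= T -> u x = u 0 + cintegral `[0, x] du.
Proof.
split=> [[[i1 h1] [i2 h2]]|[[i1 i2] h]].
  by split=> // x xT; apply: complex_ext; rewrite partsE /=; [exact: h1|exact: h2].
by split; split=> // x xT; rewrite (h x xT) partsE.
Qed.

Lemma cabscont_meas u du : cabscont u du -> cmeasurable `[0, T] u.
Proof. by move=> [a b]; split; [exact: abscont_meas a|exact: abscont_meas b]. Qed.

Lemma cabscont_bounded u du : cabscont u du -> cbounded `[0, T] u.
Proof.
move=> [/abscont_bounded [M HM] /abscont_bounded[N HN]]; exists (`|M| + `|N|) => x xT;
  split.
  by apply: le_trans (HM _ xT) _; rewrite (le_trans (ler_norm _))// lerDl.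
by apply: le_trans (HN _ xT) _; rewrite (le_trans (ler_norm _))// lerDr.
Qed.

Lemma cabscont_prim c y : cintegrable `[0, T] y ->
  cabscont (fun x => c + cintegral `[0, x] y) y.
Proof.
move=> iy; apply/cabscontE; split=> // x _; congr (_ + _).
rewrite /cintegral set_itv1 !Rintegral_set1 (_ : 0 +i* 0 = 0)// addr0//.
Qed.

Lemma cabscont_mul u du v dv : cabscont u du -> cabscont v dv -> cbounded `[0, T] du ->
  cabscont (fun x => u x * v x) (fun x => du x * v x + u x * dv x).
Proof.
move=> [u1 u2] [v1 v2] [M HM].
have M1 x : x \in `[0, T] -> `|Re (du x)| <= M by move=> /HM[].
have M2 x : x \in `[0, T] -> `|Im (du x)| <= M by move=> /HM[].
split.
  have := abscont_sub (abscont_mul T0 u1 v1 M1) (abscont_mul T0 u2 v2 M2).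
  by congr abscont; apply/funext => x; rewrite !partsE//; ring.
have := abscont_add (abscont_mul T0 u1 v2 M1) (abscont_mul T0 u2 v1 M2).
by congr abscont; apply/funext => x; rewrite !partsE//; ring.
Qed.

(** The exponential of the integral of [v] over [[0, x]], written with real functions so that the
    real chain rule applies to each factor. *)
Definition cexp v x : R[i] :=
  (expR (Re (cintegral `[0, x] v)))%:C *
  (cos (Im (cintegral `[0, x] v)) +i* sin (Im (cintegral `[0, x] v))).

(** Required on the whole line, so that [v] is integrable on every [[0, x]] without a side condition
    on [x]. *)
Definition bounded_measurable v := cmeasurable setT v /\ cbounded setT v.

Lemma bounded_measurable_cintegrable v : bounded_measurable v -> cintegrable `[0, T] v.
Proof.
move=> [[m1 m2] [M HM]]; split.
- apply: (@bounded_Rintegrable _ _ _ _ M); first exact: measurable_funTS.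
  by move=> x _; have [] := HM x.
- apply: (@bounded_Rintegrable _ _ _ _ M); first exact: measurable_funTS.
  by move=> x _; have [] := HM x.
Qed.

(** The real chain rule handles exp, cos and sin of the two parts of the primitive, with second
    derivatives bounded by e^B, 1 and 1. The product rule then joins the factors, the exponential
    one having derivative at most e^B M. *)
Lemma cexp_abscont v : bounded_measurable v ->
  cabscont (cexp v) (fun x => v x * cexp v x).
Proof.
move=> bv; have [_ [M HM]] := bv.
have M1 x : x \in `[0, T] -> `|Re (v x)| <= M by have [] := HM x.
have M2 x : x \in `[0, T] -> `|Im (v x)| <= M by have [] := HM x.
have [] := cabscont_prim 0 (bounded_measurable_cintegrable bv).
rewrite [X in abscont T X](_ : _ = fun x => Re (cintegral `[0, x] v)); last first.
  by apply/funext => x; rewrite add0r.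
rewrite [X in _ -> abscont T X _ -> _](_ : _ = fun x => Im (cintegral `[0, x] v));
  last first.
  by apply/funext => x; rewrite add0r.
set a := fun x => Re _; set b := fun x => Im _ => aA aB.
have [B hB] := abscont_bounded aA.
have [C hC] := abscont_bounded aB.
have hexp x : `|x| <= B -> `|expR x| <= expR B.
  by move=> xB; rewrite ger0_norm ?expR_ge0// ler_expR (le_trans (ler_norm _)).
have A1 : abscont T (fun x => expR (a x)) (fun x => expR (a x) * Re (v x)).
  exact: (abscont_comp (K := expR B) T0 aA M1 hB).
have dms x : is_derive (x : R) (1 : R) (fun x => - sin x) (- cos x).
  exact: is_deriveN.
have dmc x : is_derive (x : R) (1 : R) (fun x => - sin x) (- cos x).
  exact: is_deriveN.
have A2 : abscont T (fun x => cos (b x)) (fun x => - sin (b x) * Im (v x)).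
  apply: (abscont_comp (ddG := fun x => - cos x) (K := 1) T0 aB M2 hC).
  by move=> x _; rewrite normrN ler_norml cos_geN1 cos_le1.
have A3 : abscont T (fun x => sin (b x)) (fun x => cos (b x) * Im (v x)).
  apply: (abscont_comp (ddG := fun x => - sin x) (K := 1) T0 aB M2 hC).
  by move=> x _; rewrite normrN ler_norml sin_geN1 sin_le1.
have bd x : x \in `[0, T] -> `|expR (a x) * Re (v x)| <= expR B * M.
  by move=> xT; rewrite normrM ler_pM// ?M1// hexp// hB.
split.
  have := abscont_mul T0 A1 A2 bd.
  congr abscont; apply/funext => x; rewrite /cexp !partsE/= -/(a x) -/(b x); ring.
have := abscont_mul T0 A1 A3 bd.
congr abscont; apply/funext => x; rewrite /cexp !partsE/= -/(a x) -/(b x); ring.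
Qed.

Lemma cexp0 v : cexp v 0 = 1.
Proof.
rewrite /cexp /cintegral set_itv1 !Rintegral_set1/= expR0 cos0 sin0.
by rewrite mul1r.
Qed.

Lemma cexpD v w x : cintegrable `[0, x] v -> cintegrable `[0, x] w ->
  cexp (fun t => v t + w t) x = cexp v x * cexp w x.
Proof.
move=> iv iw; rewrite /cexp cintegralD// !partsE expRD cosD sinD.
by apply: complex_ext; rewrite !partsE/=; ring.
Qed.

Lemma cexpJ v x : cintegrable `[0, x] v ->
  cexp (fun t => conjc (v t)) x = conjc (cexp v x).
Proof.
move=> iv; rewrite /cexp cintegralJ// !partsE cosN sinN.
by apply: complex_ext; rewrite !partsE/=; ring.
Qed.

Lemma cexp_neq0 v x : cexp v x != 0.
Proof.
apply/eqP => /(congr1 (@sqmod R)); rewrite sqmod0 sqmodM => /eqP.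
rewrite mulf_eq0 => /orP[|]; rewrite sqmodE/=.
  by rewrite expr0n addr0 sqrf_eq0 expR_eq0.
by rewrite cos2Dsin2 oner_eq0.
Qed.

Lemma cexp_cst_im (c : R) x : 0 <= x ->
  cexp (fun=> 0 +i* c) x = cos (c * x) +i* sin (c * x).
Proof.
move=> x0; rewrite /cexp /cintegral /=.
have I (d : R) : (\int[@lebesgue_measure R]_(_ in `[0, x]) d)%R = d * x.
  transitivity (d * fine (@lebesgue_measure R `[0, x])); first exact: Rintegral_cst.
  by rewrite lebesgue_measure_itv/= lte_fin; case: ltgtP x0 => //= [_ _|<- _];
    rewrite ?subr0.
by rewrite !I mul0r expR0 mul1r.
Qed.

End ComplexAC.

(** * Square integrable functions on (0, 2 pi) *)

Section AlmostEverywhere.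
Context {R : realType}.
Local Notation leb := (@lebesgue_measure R).
Local Notation T := (twopi R).
Local Notation I := (@itv02pi R).
Implicit Types (P Q : R -> Prop).

Definition ae_itv P : Prop := {ae leb, forall x : R, I x -> P x}.

Let aeF : Filter (nbhs (almost_everywhere leb)).
Proof. by apply: ae_filter_ringOfSetsType. Qed.

Lemma ae_itvW P : (forall x, I x -> P x) -> ae_itv P.
Proof. by move=> h; apply: aeW => x; exact: h. Qed.

Lemma ae_itv1 P Q : (forall x, I x -> P x -> Q x) -> ae_itv P -> ae_itv Q.
Proof. by move=> PQ; have F := aeF; rewrite /ae_itv; apply: filterS => x Px Ix;
  apply: PQ (Px Ix). Qed.

Lemma ae_itv2 P Q S : (forall x, I x -> P x -> Q x -> S x) -> ae_itv P -> ae_itv Q ->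
  ae_itv S.
Proof. by move=> PQ; have F := aeF; rewrite /ae_itv; apply: filterS2 => x Px Qx Ix;
  apply: PQ (Px Ix) (Qx Ix). Qed.

Lemma twopi_gt0 : 0 < T.
Proof. by rewrite /twopi mulr_gt0// pi_gt0. Qed.

Lemma twopi_ge0 : 0 <= T.
Proof. exact: ltW twopi_gt0. Qed.

Lemma itv02piP x : I x <-> 0 < x < T.
Proof. by rewrite /itv02pi /= in_itv. Qed.

Lemma itv02pi_sub : I `<=` `[0, T].
Proof. by move=> x /itv02piP/andP[a b]; rewrite /= in_itv/= !ltW. Qed.

Lemma measurable_I02pi : measurable I.
Proof. exact: measurable_itv02pi. Qed.

(** Even at an endpoint, a neighbourhood of [x] cut down to (0, 2 pi) is an interval of positive
    length, so it is not contained in a null set. *)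
Lemma ae_itv_dense P x e : ae_itv P -> 0 <= x <= T -> 0 < e ->
  exists y, [/\ I y, `|x - y| < e & P y].
Proof.
move=> aP /andP[x0 xT] e0; apply: contrapT => no.
pose a := Num.max 0 (x - e); pose b := Num.min T (x + e).
have ab : a < b.
  rewrite /a /b gt_max !lt_min twopi_gt0 /=.
  apply/andP; split; first lra.
  apply/andP; split; lra.
have neg : leb.-negligible `]a, b[.
  apply: negligibleS aP => y; rewrite /= in_itv/= /a /b gt_max lt_min.
  move=> /andP[/andP[y0 y1] /andP[y2 y3]] H; apply: no; exists y.
  have Iy : I y by apply/itv02piP; rewrite y0.
  split=> //; last exact: H.
  by rewrite ltr_norml; apply/andP; split; lra.
have : leb `]a, b[ = 0 by exact/negligibleP.
rewrite lebesgue_measure_itv/= lte_fin ab => /eqP; rewrite eqe subr_eq0.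
by rewrite gt_eqF.
Qed.

(** Primitives are continuous and the points where [u] vanishes are dense. This is how almost
    everywhere identities yield boundary values. *)
Lemma abscont_ae0 (u du : R -> R) : abscont T u du -> ae_itv (fun x => u x = 0) ->
  forall x, 0 <= x <= T -> u x = 0.
Proof.
move=> [di H] ae x xT.
have c := parameterized_integral_continuous twopi_ge0 di.
apply/eqP; rewrite -normr_le0; apply/ler_addgt0Pr => e e0; rewrite add0r.
have xI : `[0, T]%classic x by rewrite /= in_itv.
have /subspace_continuousP/(_ x xI) := c.
move=> /cvgrPdist_lt/(_ e e0); rewrite near_withinE => /nbhs_ballP[d /= d0 hd].
have [y [Iy xy uy]] := ae_itv_dense ae xT d0.
have yI := itv02pi_sub Iy.
have yT : 0 <= y <= T by move: yI; rewrite /= in_itv.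
have -> : u x = u x - u y by rewrite uy subr0.
rewrite (H x xT) (H y yT) (_ : _ - _ = parameterized_integral leb 0 x du -
  parameterized_integral leb 0 y du); last by rewrite /parameterized_integral; ring.
exact: ltW (hd y xy yI).
Qed.

Lemma cabscont_ae_eq (u du v dv : R -> R[i]) : cabscont T u du -> cabscont T v dv ->
  ae_itv (fun x => u x = v x) -> forall x, 0 <= x <= T -> u x = v x.
Proof.
move=> [u1 u2] [v1 v2] ae x xT; apply: complex_ext; apply/eqP; rewrite -subr_eq0;
  apply/eqP.
  by apply: (abscont_ae0 (abscont_sub u1 v1)) => //; apply: ae_itv1 ae => t _ ->;
    rewrite subrr.
by apply: (abscont_ae0 (abscont_sub u2 v2)) => //; apply: ae_itv1 ae => t _ ->;
  rewrite subrr.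
Qed.

End AlmostEverywhere.

(** * Square integrability, and the inhomogeneous first order equation *)

Section SquareIntegrable.
Context {R : realType}.
Local Notation leb := (@lebesgue_measure R).
Local Notation T := (twopi R).
Local Notation I := (@itv02pi R).
Implicit Types (u v w y : R -> R[i]).

Lemma Rintegrable_closed (f : R -> R) : Rintegrable I f -> Rintegrable `[0, T] f.
Proof.
move=> /integrableP[mf fi].
have mf' : measurable_fun `[0, T] (EFin \o f) by exact: emeasurable_fun_itv_cc mf.
apply/integrableP; split=> //.
rewrite -integral_itv_obnd_cbnd//; last first.
  apply: measurableT_comp => //; apply: measurable_funS mf' => //.
  exact: subset_itv_oc_cc.
rewrite -integral_itv_bndo_bndc//.
exact: measurableT_comp.
Qed.

Lemma is_L2P u : is_L2 u <-> cmeasurable I u /\ Rintegrable I (fun x => sqmod (u x)).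
Proof.
have E : (\int[leb]_(x in I) `|(EFin \o (fun x => sqmod (u x))) x| =
    \int[leb]_(x in I) (sqmod (u x))%:E)%E.
  by apply: eq_integral => x _; rewrite /= ger0_norm ?sqmod_ge0.
split=> [[mu fu]|[mu /integrableP[_ fu]]]; split=> //; last by rewrite -E.
by apply/integrableP; split; [exact: measurable_sqmod|rewrite E].
Qed.

Lemma is_L2_le u v C : cmeasurable I u -> is_L2 v ->
  (forall x, I x -> sqmod (u x) <= C * sqmod (v x)) -> is_L2 u.
Proof.
move=> mu /is_L2P[mv iv] uv; apply/is_L2P; split=> //.
apply: (@le_Rintegrable _ _ _ (fun x => C * sqmod (v x))) => //.
- exact: measurable_I02pi.
- by apply/measurable_EFinP; exact: measurable_sqmod.
- move=> x Ix; rewrite ger0_norm ?sqmod_ge0//.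
  by apply: le_trans (uv x Ix) _; exact: ler_norm.
- by apply: RintegrableZl => //; exact: measurable_I02pi.
Qed.

Lemma is_L2M u v : cmeasurable I u -> cbounded I u -> is_L2 v ->
  is_L2 (fun x => u x * v x).
Proof.
move=> mu /cbounded_sqmod[M M0 HM] hv; apply: (is_L2_le (C := M)) (hv) _.
  by apply: cmeasurableM => //; exact: hv.1.
by move=> x Ix; rewrite sqmodM ler_wpM2r ?sqmod_ge0// HM.
Qed.

Lemma is_L2_cst (c : R[i]) : is_L2 (fun=> c).
Proof.
apply/is_L2P; split; first exact: cmeasurable_cst.
exact: Rintegrable_cst_itv.
Qed.

Lemma is_L2_bounded u : cmeasurable I u -> cbounded I u -> is_L2 u.
Proof.
move=> mu bu; have := is_L2M mu bu (is_L2_cst 1).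
by congr is_L2; apply/funext => x; rewrite mulr1.
Qed.

Lemma is_L2D u v : is_L2 u -> is_L2 v -> is_L2 (fun x => u x + v x).
Proof.
move=> hu hv; have := is_L2_lin 1 hu hv; congr is_L2; apply/funext => x.
by rewrite -[RHS](congr1 (fun z => z + v x) (mul1r (u x))).
Qed.

Lemma is_L2Z c u : is_L2 u -> is_L2 (fun x => c * u x).
Proof. by move=> hu; apply: is_L2M hu;
  [exact: cmeasurable_cst|exact: cbounded_cst]. Qed.

Lemma is_L2J u : is_L2 u -> is_L2 (fun x => conjc (u x)).
Proof.
move=> hu; apply: (is_L2_le (C := 1)) (hu) _; first exact/cmeasurableJ/hu.1.
by move=> x _; rewrite sqmodJ mul1r.
Qed.

(** Young's inequality with a crude constant, enough to make the product of two square integrable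
    functions integrable. *)
Lemma abs_parts_sqmod (z w : R[i]) :
  `|Re (conjc z * w)| <= sqmod z + sqmod w /\ `|Im (conjc z * w)| <= sqmod z + sqmod w.
Proof.
case: z w => [a b] [c d]; rewrite !sqmodE !partsE /=.
have := sqr_ge0 (a - c); have := sqr_ge0 (b - d); have := sqr_ge0 (a + c).
have := sqr_ge0 (b + d); have := sqr_ge0 (a - d); have := sqr_ge0 (a + d).
have := sqr_ge0 (b - c); have := sqr_ge0 (b + c).
by move=> *; split; rewrite ler_norml; apply/andP; split; nra.
Qed.

Lemma is_L2_prod_cintegrable u v : is_L2 u -> is_L2 v ->
  cintegrable I (fun x => conjc (u x) * v x).
Proof.
move=> /is_L2P[mu iu] /is_L2P[mv iv].
have [m1 m2] := cmeasurableM (cmeasurableJ mu) mv.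
have is2 : Rintegrable I (fun x => sqmod (u x) + sqmod (v x)) by apply: RintegrableD =>
  //; exact: measurable_I02pi.
split; apply: (@le_Rintegrable _ _ _ (fun x => sqmod (u x) + sqmod (v x))) => //;
  try exact: measurable_I02pi; move=> x _.
- by rewrite [leRHS]ger0_norm ?addr_ge0 ?sqmod_ge0//;
  have [] := abs_parts_sqmod (u x) (v x).
- by rewrite [leRHS]ger0_norm ?addr_ge0 ?sqmod_ge0//;
  have [] := abs_parts_sqmod (u x) (v x).
Qed.

Lemma is_L2_cintegrable_open u : is_L2 u -> cintegrable I u.
Proof.
move=> /(is_L2_prod_cintegrable (is_L2_cst 1)) [a b]; split.
  by apply: eq_integrable a => [|x _];
    [exact: measurable_I02pi|change ((Re (conjc 1 * u x))%:E = (Re (u x))%:E);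
      rewrite conjc1 mul1r].
by apply: eq_integrable b => [|x _];
  [exact: measurable_I02pi|change ((Im (conjc 1 * u x))%:E = (Im (u x))%:E);
    rewrite conjc1 mul1r].
Qed.

Lemma is_L2_cintegrable u : is_L2 u -> cintegrable `[0, T] u.
Proof. by move=> /is_L2_cintegrable_open[a b]; split; exact: Rintegrable_closed. Qed.

Lemma is_H1P u du : is_H1 u du <-> is_L2 du /\ cabscont T u du.
Proof.
split=> [[h H]|[h /cabscontE[_ H]]]; split=> //.
by apply/cabscontE; split=> //; exact: is_L2_cintegrable.
Qed.

Lemma cintegral_openE u : is_L2 u -> cintegral I u = cintegral `[0, T] u.
Proof.
move=> hu; have [i1 i2] := is_L2_cintegrable hu.
have h (f : R -> R) : Rintegrable `[0, T] f ->
    (\int[leb]_(x in I) f x = \int[leb]_(x in `[0, T]) f x)%R.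
  move=> fi; have fo : Rintegrable `]0, T] f by apply: RintegrableS fi => //;
    exact: subset_itv_oc_cc.
  rewrite -Rintegral_itv_obnd_cbnd// -Rintegral_itv_bndo_bndc//.
  by apply: RintegrableS fi => //; exact: itv02pi_sub.
by congr (_ +i* _); exact: h.
Qed.

Lemma cabscont_is_L2 u du : cabscont T u du -> is_L2 u.
Proof.
move=> ac; apply: is_L2_bounded.
  by apply: cmeasurableS (cabscont_meas twopi_ge0 ac) => //; exact: itv02pi_sub.
exact: cboundedS itv02pi_sub (cabscont_bounded ac).
Qed.

Lemma cexp_L2 v : bounded_measurable v -> cmeasurable I (cexp v) /\ cbounded I (cexp v).
Proof.
move=> bv; have ac := cexp_abscont twopi_ge0 bv; split.
  by apply: cmeasurableS (cabscont_meas twopi_ge0 ac) => //; exact: itv02pi_sub.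
exact: cboundedS itv02pi_sub (cabscont_bounded ac).
Qed.

Lemma bounded_measurableI v : bounded_measurable v -> cmeasurable I v /\ cbounded I v.
Proof.
by move=> [mv bv]; split; [exact: cmeasurableS mv|exact: cboundedS bv].
Qed.

(** The product rule for E = [cexp v], whose derivative is bounded, and a primitive of [y], which is
    only square integrable. The function solves u' = v u + E y with u(0) = c. *)
Lemma variation_of_constants v y c : bounded_measurable v -> is_L2 y ->
  is_H1 (fun x => cexp v x * (c + cintegral `[0, x] y))
    (fun x => v x * (cexp v x * (c + cintegral `[0, x] y)) + cexp v x * y x).
Proof.
move=> bv hy; apply/is_H1P.
have ace := cexp_abscont twopi_ge0 bv.
have acy := cabscont_prim c (is_L2_cintegrable hy).
have bvE : cbounded `[0, T] (fun x => v x * cexp v x).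
  apply: cboundedM; last exact: cabscont_bounded ace.
  by apply: cboundedS bv.2.
have ac : cabscont T (fun x => cexp v x * (c + cintegral `[0, x] y))
    (fun x => v x * (cexp v x * (c + cintegral `[0, x] y)) + cexp v x * y x).
  have := cabscont_mul twopi_ge0 ace acy bvE.
  by congr cabscont; apply/funext => x; rewrite mulrA.
split=> //; apply: is_L2D.
  have [m b] := bounded_measurableI bv; apply: is_L2M => //; exact: cabscont_is_L2 ac.
by have [m b] := cexp_L2 bv; apply: is_L2M.
Qed.

(** [V] is set to 0 outside the part of (0, 2 pi) where its modulus is at most |M|. Inside the
    interval this changes it on a null set only, and the bound then holds at every point of the
    line. *)
Lemma Linfty_patch (V : R -> R[i]) : is_Linfty V ->
  exists2 V' : R -> R[i], bounded_measurable V' & ae_itv (fun x => V x = V' x).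
Proof.
move=> [mV [M HM]].
pose A := I `&` [set x | sqmod (V x) <= M ^+ 2].
have msq : measurable_fun I (fun x => sqmod (V x)).
  by apply/measurable_EFinP; exact: measurable_sqmod.
have mA : measurable A.
  by apply: measurable_fun_le => //; exact: measurable_I02pi.
have AI : A `<=` I by move=> x [].
exists (fun x => if x \in A then V x else 0).
  split.
    have [m1 m2] := cmeasurableS measurable_I02pi AI mV.
    split.
      have := (measurable_restrictT (fun x => Re (V x)) mA).1 m1.
      by congr measurable_fun; apply/funext => x; rewrite patchE; case: ifP.
    have := (measurable_restrictT (fun x => Im (V x)) mA).1 m2.
    by congr measurable_fun; apply/funext => x; rewrite patchE; case: ifP.
  exists `|M| => x _; case: ifPn => [|_]; last first.
    by rewrite /= normr0.
  rewrite inE => -[_ /=]; rewrite sqmodE -[M ^+ 2]real_normK ?num_real// => h.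
  have h1 (a b : R) : a ^+ 2 + b ^+ 2 <= `|M| ^+ 2 -> `|a| <= `|M|.
    move=> h'; rewrite -(@ler_pXn2r _ 2%N)// ?nnegrE// real_normK ?num_real//.
    by apply: le_trans h'; rewrite lerDl sqr_ge0.
  by split; apply: h1 h || (rewrite addrC in h; apply: h1 h).
apply: ae_itv1 HM => x Ix h; rewrite mem_set//.
split=> //=; rewrite /sqmod lerXn2r// ?nnegrE.
  by case: (V x) => a b /=; rewrite sqrtr_ge0.
by apply: le_trans h; case: (V x) => a b /=; rewrite sqrtr_ge0.
Qed.

End SquareIntegrable.

(** * The space L^2 and real eigenvalues of dissipative operators *)

Section SquareNorm.
Context {R : realType}.
Local Notation leb := (@lebesgue_measure R).
Local Notation T := (twopi R).
Local Notation I := (@itv02pi R).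
Implicit Types (u v w y : R -> R[i]).

Definition sqnorm u : R := (\int[leb]_(x in I) sqmod (u x))%R.

Lemma is_L2_Rintegrable u : is_L2 u -> Rintegrable I (fun x => sqmod (u x)).
Proof. by move=> /is_L2P[]. Qed.

Lemma sqnorm_ge0 u : 0 <= sqnorm u.
Proof. by apply: Rintegral_ge0 => x _; exact: sqmod_ge0. Qed.

Lemma cintegral_sqnorm u : is_L2 u ->
  cintegral I (fun x => conjc (u x) * u x) = (sqnorm u)%:C.
Proof.
move=> _; apply: complex_ext => /=.
  by apply: eq_Rintegral => x _ /=; rewrite sqmodE !partsE; ring.
transitivity (\int[leb]_(x in I) (0 : R))%R.
  by apply: eq_Rintegral => x _ /=; rewrite !partsE; ring.
by rewrite Rintegral_cst ?mul0r//; exact: measurable_I02pi.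
Qed.

Lemma sqnorm_eq0 u : is_L2 u -> sqnorm u = 0 -> ae_itv (fun x => u x = 0).
Proof.
move=> hu u0.
have msq : measurable_fun I (EFin \o (fun x => sqmod (u x))).
  by have /is_L2_Rintegrable/Rintegrable_meas m := hu; apply/measurable_EFinP.
have i0 : (\int[leb]_(x in I) `|(EFin \o (fun x => sqmod (u x))) x| = 0)%E.
  transitivity (\int[leb]_(x in I) (sqmod (u x))%:E)%E.
    by apply: eq_integral => x _; rewrite /= ger0_norm ?sqmod_ge0.
  have fin : (\int[leb]_(x in I) (sqmod (u x))%:E)%E \is a fin_num.
    rewrite ge0_fin_numE; first by case: hu.
    by apply: integral_ge0 => x _; rewrite lee_fin sqmod_ge0.
  by rewrite -(fineK fin); move: u0; rewrite /sqnorm /Rintegral => ->.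
have /(ae_eq_integral_abs leb measurable_I02pi msq) h := i0.
by apply: ae_itv1 h => x Ix [] e; exact: sqmod_eq0.
Qed.

Lemma le_sqnorm u v C : is_L2 u -> is_L2 v ->
  (forall x, I x -> sqmod (u x) <= C * sqmod (v x)) -> sqnorm u <= C * sqnorm v.
Proof.
move=> hu hv uv; rewrite /sqnorm -RintegralZl;
  [|exact: measurable_I02pi|exact: is_L2_Rintegrable].
apply: le_Rintegral => //; [exact: measurable_I02pi|exact: is_L2_Rintegrable|].
by apply: RintegrableZl; [exact: measurable_I02pi|exact: is_L2_Rintegrable].
Qed.

Lemma sqnorm_lin a u v : is_L2 u -> is_L2 v ->
  sqnorm (fun x => a * u x + v x) <= 2 * sqmod a * sqnorm u + 2 * sqnorm v.
Proof.
move=> hu hv; have mi := @measurable_I02pi R.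
have iu := is_L2_Rintegrable hu; have iv := is_L2_Rintegrable hv.
rewrite /sqnorm -!RintegralZl// -RintegralD//; try exact: RintegrableZl.
apply: le_Rintegral => //.
- by apply: is_L2_Rintegrable; apply: is_L2D => //; exact: is_L2Z.
- by apply: RintegrableD => //; exact: RintegrableZl.
- by move=> x _; exact: sqmod_lin.
Qed.

Lemma Rintegral_I_cst (c : R) : (\int[leb]_(x in I) c)%R = c * T.
Proof.
transitivity (c * fine (leb I)); first by apply: Rintegral_cst; exact: measurable_I02pi.
by rewrite lebesgue_measure_itv/= lte_fin twopi_gt0 /= subr0.
Qed.

Lemma sqnorm_cst (c : R[i]) : sqnorm (fun=> c) = sqmod c * T.
Proof. exact: Rintegral_I_cst. Qed.

(** Nonnegativity of the variance: the integral of (f - m / x)^2 is expanded, m / x being the mean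
    of [f] over [[0, x]]. *)
Lemma cauchy_schwarz_itv (f : R -> R) x : 0 < x -> Rintegrable `[0, x] f ->
  Rintegrable `[0, x] (fun t => f t ^+ 2) ->
  (\int[leb]_(t in `[0, x]) f t) ^+ 2 <= x * \int[leb]_(t in `[0, x]) (f t ^+ 2).
Proof.
move=> x0 fi f2; set m := (\int[leb]_(t in `[0, x]) f t)%R.
have xn0 : x != 0 by rewrite gt_eqF.
have c (r : R) : (\int[leb]_(t in `[0, x]) r)%R = r * x.
  transitivity (r * fine (leb `[0, x])); first exact: Rintegral_cst.
  by rewrite lebesgue_measure_itv/= lte_fin x0/= subr0.
have : 0 <= (\int[leb]_(t in `[0, x]) ((f t - m / x) ^+ 2))%R.
  by apply: Rintegral_ge0 => t _; exact: sqr_ge0.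
have -> : (\int[leb]_(t in `[0, x]) ((f t - m / x) ^+ 2) =
   \int[leb]_(t in `[0, x]) ((f t ^+ 2 - 2 * (m / x) * f t) + (m / x) ^+ 2))%R.
  by apply: eq_Rintegral => t _; ring.
rewrite RintegralD//; last 2 first.
- by apply: RintegrableB => //; exact: RintegrableZl.
- exact: Rintegrable_cst_itv.
rewrite RintegralB//; last exact: RintegrableZl.
rewrite RintegralZl// c -/m => h.
have -> : x * \int[leb]_(t in `[0, x]) (f t ^+ 2) = m ^+ 2 + x *
  (\int[leb]_(t in `[0, x]) (f t ^+ 2) - 2 * (m / x) * m + (m / x) ^+ 2 * x) by field.
by rewrite lerDl mulr_ge0// ltW.
Qed.

(** Cauchy-Schwarz for the real and imaginary parts, after which [[0, x]] is enlarged to the whole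
    interval. The bound is uniform in [x] and serves to bound the resolvent. *)
Lemma sqmod_prim u x : is_L2 u -> 0 <= x <= T ->
  sqmod (cintegral `[0, x] u) <= T * sqnorm u.
Proof.
(* The case x = 0 is treated apart because the mean over [[0, x]] divides by [x]. *)
move=> hu /andP[]; rewrite le_eqVlt => /predU1P[<- _|x0 xT].
  rewrite /cintegral set_itv1 !Rintegral_set1 sqmodE/= !expr0n/= addr0.
  by rewrite mulr_ge0 ?sqnorm_ge0// twopi_ge0.
have sub : `[0, x] `<=` `[0, T].
  by move=> t; rewrite /= !in_itv/= => /andP[-> tx]; exact: le_trans xT.
have [i1 i2] := is_L2_cintegrable hu.
have is2 := Rintegrable_closed (is_L2_Rintegrable hu).
have [m1 m2] := (Rintegrable_meas i1, Rintegrable_meas i2).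
have s1 : Rintegrable `[0, T] (fun t => Re (u t) ^+ 2).
  apply: (le_Rintegrable _ _ _ is2) => //; first exact: measurable_funX.
  move=> t _; rewrite sqmodE !ger0_norm ?addr_ge0 ?sqr_ge0//.
  by rewrite lerDl sqr_ge0.
have s2 : Rintegrable `[0, T] (fun t => Im (u t) ^+ 2).
  apply: (le_Rintegrable _ _ _ is2) => //; first exact: measurable_funX.
  move=> t _; rewrite sqmodE !ger0_norm ?addr_ge0 ?sqr_ge0//.
  by rewrite lerDr sqr_ge0.
have r (f : R -> R) : Rintegrable `[0, T] f -> Rintegrable `[0, x] f.
  by move=> fi; apply: RintegrableS fi.
rewrite sqmodE /=; apply: (@le_trans _ _ (x * \int[leb]_(t in `[0, x]) (sqmod (u t)))).
  rewrite (_ : (\int[leb]_(t in `[0, x]) (sqmod (u t)))%R =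
    (\int[leb]_(t in `[0, x]) (Re (u t) ^+ 2) + \int[leb]_(t in `[0,
      x]) (Im (u t) ^+ 2))%R).
    by rewrite mulrDr lerD// cauchy_schwarz_itv//; exact: r.
  rewrite -RintegralD//; [|exact: r|exact: r].
  by apply: eq_Rintegral => t _; rewrite sqmodE.
apply: ler_pM; [exact: ltW| |exact: xT|].
  by apply: Rintegral_ge0 => t _; exact: sqmod_ge0.
have -> : sqnorm u = (\int[leb]_(t in `[0, T]) (sqmod (u t)))%R.
  rewrite /sqnorm -Rintegral_itv_obnd_cbnd; last first.
    by apply: RintegrableS is2 => //; exact: subset_itv_oc_cc.
  by rewrite -Rintegral_itv_bndo_bndc//; exact: is_L2_Rintegrable.
rewrite -subr_ge0; have := Rintegral_itv_diff is2 (ltW x0) xT (lexx T).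
by move=> ->; apply: Rintegral_ge0 => t _; exact: sqmod_ge0.
Qed.

End SquareNorm.

(** * Representatives and the inner product on L^2 *)

Section L2Space.
Context {R : realType}.
Local Notation leb := (@lebesgue_measure R).
Local Notation T := (twopi R).
Local Notation I := (@itv02pi R).
Implicit Types (u v w : R -> R[i]) (f g h : L2 R).

Lemma L2repr_is_L2 f : is_L2 (L2repr f).
Proof. by have /asboolP := L2valP (repr f). Qed.

Lemma represents_repr f : represents (L2repr f) f.
Proof. exact: ae_itvW. Qed.

Lemma represents_ae u v f : represents u f -> ae_itv (fun x => u x = v x) ->
  represents v f.
Proof. by move=> h1 h2; apply: ae_itv2 h1 h2 => x _ ->. Qed.

Lemma represents_ae_eq u v f : represents u f -> represents v f ->
  ae_itv (fun x => u x = v x).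
Proof. by move=> h1 h2; apply: ae_itv2 h1 h2 => x _ <-. Qed.

Lemma represents_pi (p : L2fun R) : represents p (\pi_(L2 R) p).
Proof.
have /eqP := reprK (\pi_(L2 R) p); rewrite piE /Quotient.equiv => /asboolP h.
by apply: ae_itv1 h => x _ hx; apply: subr0_eq.
Qed.

Lemma represents_lin a u v f g : represents u f -> represents v g ->
  represents (fun x => a * u x + v x) (a *: f + g).
Proof.
move=> hu hv.
have -> : a *: f + g = \pi_(L2 R) (a *: repr f + repr g).
  by rewrite pi_L2D pi_L2_scale !reprK.
apply: represents_ae (represents_pi _) _.
by apply: ae_itv2 hu hv => x _ <- <-.
Qed.

Lemma represents_0 : represents (fun=> 0) (0 : L2 R).
Proof.
have := represents_lin 0 (represents_repr 0) (represents_repr 0).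
rewrite scale0r addr0 => h.
(* The representative chosen for the zero class is known to vanish only almost everywhere; combined
   with itself with coefficient -1 it gives the function that is identically zero. *)
have := represents_lin (-1) h h.
rewrite scaler0 addr0 => h2; apply: represents_ae h2 _.
by apply: ae_itvW => x _; ring.
Qed.

(** [ip2] is defined through chosen representatives; this frees it from the choice, so that it can
    be computed from explicit formulas. *)
Lemma ip2E u v f g : is_L2 u -> is_L2 v -> represents u f -> represents v g ->
  ip2 f g = cintegral I (fun x => conjc (u x) * v x).
Proof.
move=> Lu Lv hu hv; apply: ae_eq_cintegral; first exact: measurable_I02pi.
- by apply: cmeasurableM; [apply: cmeasurableJ|]; exact: (L2repr_is_L2 _).1.
- by apply: cmeasurableM; [apply: cmeasurableJ; exact: Lu.1|exact: Lv.1].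
- by apply: ae_itv2 hu hv => x _ -> ->.
Qed.

Lemma ip2_linr a f g h : ip2 f (a *: g + h) = a * ip2 f g + ip2 f h.
Proof.
have [[Lf Lg] Lh] := (L2repr_is_L2 f, L2repr_is_L2 g, L2repr_is_L2 h).
have Lgh := is_L2D (is_L2Z a Lg) Lh.
rewrite (ip2E Lf Lgh (represents_repr f)
  (represents_lin a (represents_repr g) (represents_repr h))).
have [i1 i2] := (is_L2_prod_cintegrable Lf Lg, is_L2_prod_cintegrable Lf Lh).
have mi := @measurable_I02pi R.
rewrite /ip2 -cintegralZ// -cintegralD//; last exact: cintegrableZ.
by apply: eq_cintegral => x _; ring.
Qed.

Lemma ip2C f g : ip2 g f = conjc (ip2 f g).
Proof.
have [Lf Lg] := (L2repr_is_L2 f, L2repr_is_L2 g).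
rewrite /ip2 -cintegralJ; [|exact: measurable_I02pi|exact: is_L2_prod_cintegrable].
by apply: eq_cintegral => x _; apply: complex_ext; rewrite !partsE; ring.
Qed.

Lemma ip2r0 f : ip2 f 0 = 0.
Proof. by have := ip2_linr 1 f 0 0; rewrite scale1r addr0 mul1r => /eqP;
  rewrite -subr_eq0 opprD addNKr oppr_eq0 => /eqP. Qed.

Lemma ip2rZ a f g : ip2 f (a *: g) = a * ip2 f g.
Proof. by have := ip2_linr a f g 0; rewrite !addr0 ip2r0 addr0. Qed.

Lemma ip2_linl a f g h : ip2 (a *: g + h) f = conjc a * ip2 g f + ip2 h f.
Proof.
by rewrite ip2C ip2_linr (ip2C g f) (ip2C h f); apply: complex_ext; rewrite !partsE;
  ring.
Qed.

Lemma ip2_sqnorm u f : is_L2 u -> represents u f -> ip2 f f = (sqnorm u)%:C.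
Proof. by move=> Lu hu; rewrite (ip2E Lu Lu hu hu) cintegral_sqnorm. Qed.

Lemma ip2_eq0 f : ip2 f f = 0 -> f = 0.
Proof.
have Lf := L2repr_is_L2 f.
rewrite (ip2_sqnorm Lf (represents_repr f)) => -[] /(sqnorm_eq0 Lf) h.
exact: represents_inj (represents_ae (represents_repr f) h) represents_0.
Qed.

Lemma hnormE u f : is_L2 u -> represents u f -> hnorm (@ip2 R) f = Num.sqrt (sqnorm u).
Proof. by move=> Lu hu; rewrite /hnorm (ip2_sqnorm Lu hu). Qed.

End L2Space.

(** * Orthogonality relations at a real eigenvalue *)

Section DissipativeOperators.
Context {R : realType}.
Variable A : graph (L2 R).
Hypothesis Adiss : dissipative (@ip2 R) A.
Implicit Types (f g h : L2 R) (lam : R).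

Let Alin : linear_operator A. Proof. by case: Adiss. Qed.

Lemma shift_op_linear mu (a : R[i]) f f' g g' : shift_op A mu (f, g) ->
  shift_op A mu (f', g') ->
  shift_op A mu (a *: f + f', a *: g + g').
Proof.
move=> h1 h2; case: Alin => _ L _; have := L a _ _ _ _ h1 h2.
rewrite /shift_op /=; congr A; congr pair.
by rewrite !scalerDr !scalerA (mulrC mu) !addrA; congr (_ + _); rewrite addrAC.
Qed.

(* The form Im<f, Af> is nonnegative on dom A and vanishes at a real
   eigenvector, so its first variation there vanishes too. *)
Lemma real_eigenvector_orth lam f g g' : op_eigenspace A lam%:C f ->
  shift_op A lam%:C (g, g') -> ip2 f g' = 0.
Proof.
rewrite /op_eigenspace /shift_op /= add0r => Af Ag.
have [_ L _] := Alin; have [_ _ pos] := Adiss.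
set G := g' + lam%:C *: g in Ag.
set z := ip2 f g'.
have c0 := pos _ _ Ag; set c := Im (ip2 g G) in c0.
(* This is the form at t g + f. The term <f, Af> is real, and the contributions of [lam] to the two
   cross terms are conjugate to each other, so only Im(t z) and the quadratic term survive. *)
have key (t : R[i]) : 0 <= Im (t * z) + sqmod t * c.
  have := pos _ _ (L t _ _ _ _ Ag Af).
  rewrite ip2_linl !ip2_linr !ip2rZ /c /G (ip2C f g) !(addrC g') !ip2_linr -/z.
  have ff : Im (ip2 f f) = 0.
    by rewrite (ip2_sqnorm (L2repr_is_L2 f) (represents_repr f)).
  have : Im (ip2 g g) = 0.
    by rewrite (ip2_sqnorm (L2repr_is_L2 g) (represents_repr g)).
  move: ff; move: (ip2 f f) (ip2 g g) (ip2 g g') (ip2 f g) z => a b d p z'.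
  rewrite sqmodE !partsE /= => a0 b0; rewrite ?a0 ?b0 => h.
  apply: le_trans h _; rewrite le_eqVlt; apply/orP; left; apply/eqP; ring.
(* With this [t] the linear term is -|z|^2 / (c + 1) and the quadratic one c |z|^2 / (c + 1)^2;
   their sum is -|z|^2 / (c + 1)^2, which forces z = 0. The added 1 covers the case c = 0. *)
have := key ((- (c + 1)^-1)%:C * ('i%C * conjc z)).
have c1 : 0 < c + 1 by lra.
rewrite !sqmodM sqmodJ; set s := (c + 1)^-1.
have s0 : 0 < s by rewrite invr_gt0.
have sc : s * c = 1 - s by rewrite /s; field; rewrite gt_eqF.
have -> : Im ((- s)%:C * ('i%C * conjc z) * z) = - s * sqmod z.
  by rewrite sqmodE !partsE /=; ring.
have -> : sqmod ((- s)%:C : R[i]) = s ^+ 2 by rewrite sqmodE /=; ring.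
have -> : sqmod ('i%C : R[i]) = 1 by rewrite sqmodE /=; ring.
have -> : - s * sqmod z + s ^+ 2 * (1 * sqmod z) * c = - (s ^+ 2) * sqmod z.
  by rewrite (_ : s ^+ 2 * _ * c = s * (s * c) * sqmod z); [rewrite sc|]; ring.
rewrite mulNr oppr_ge0 => h.
apply: sqmod_eq0; apply/eqP; rewrite eq_le sqmod_ge0 andbT.
by rewrite -(@pmulr_rle0 _ (s ^+ 2)) ?exprn_gt0.
Qed.

(** If (A - lam) f = h with [h] in the eigenspace, then [h] is orthogonal to the range of A - lam,
    which contains [h] itself, so h = 0. Induction on the exponent does the rest. *)
Lemma root_space_real lam : root_space A lam%:C = op_eigenspace A lam%:C.
Proof.
apply/seteqP; split=> f; last first.
  by move=> h; exists 1%N; exists 0.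
case=> j; elim: j f => [|j IH] f /=.
  move=> ->; rewrite /op_eigenspace /shift_op /= scaler0 addr0.
  by case: Alin.
case=> h /= Sfh /IH Eh; rewrite /op_eigenspace /=.
by have := ip2_eq0 (real_eigenvector_orth Eh Sfh) => h0; rewrite -h0.
Qed.

(** Induction on the exponent. If (A - mu) g = h with [h] already orthogonal to [f], then (A - lam)
    g = h + (mu - lam) g lies in the range of A - lam, so (mu - lam) <f, g> = 0. *)
Lemma real_eigenvector_orth_root lam mu f g : mu != lam%:C ->
  op_eigenspace A lam%:C f -> root_space A mu g -> ip2 f g = 0.
Proof.
move=> ne Ef [j]; elim: j g => [|j IH] g /=; first by move=> ->; rewrite ip2r0.
case=> h /= Sgh /IH fh.
have Sg : shift_op A lam%:C (g, h + (mu - lam%:C) *: g).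
  rewrite /shift_op /= -addrA -scalerDl subrK; exact: Sgh.
have := real_eigenvector_orth Ef Sg.
rewrite addrC ip2_linr fh addr0 => /eqP; rewrite mulf_eq0 subr_eq0 (negPf ne) /=.
by move/eqP.
Qed.

End DissipativeOperators.

(** * Real eigenfunctions of the first order operator *)

Section FirstOrderOperator.
Context {R : realType}.
Local Notation leb := (@lebesgue_measure R).
Local Notation T := (twopi R).
Local Notation I := (@itv02pi R).
(* V' is a representative of V that is bounded everywhere. *)
Variables V V' : R -> R[i].
Hypothesis V'b : bounded_measurable V'.
Hypothesis VV' : ae_itv (fun x => V x = V' x).
Implicit Types (u v w y : R -> R[i]) (f g h k : L2 R) (rho b : R[i]).

(** [sol] solves i u' + V' u = lam u, and [adj_sol] the formal adjoint equation, in which V' is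
    replaced by its conjugate; both equal 1 at 0. They are E and F. *)
Definition gen_coef (lam : R) x : R[i] := 'i%C * (V' x - lam%:C).
Definition adj_coef (lam : R) x : R[i] := 'i%C * (conjc (V' x) - lam%:C).
Definition sol lam := cexp (gen_coef lam).
Definition adj_sol lam := cexp (adj_coef lam).

Lemma gen_coef_bounded_measurable lam : bounded_measurable (gen_coef lam).
Proof.
split.
  apply: cmeasurableM; first exact: cmeasurable_cst.
  by apply: cmeasurableD; [exact: V'b.1|exact: cmeasurable_cst].
apply: cboundedM; first exact: cbounded_cst.
by apply: cboundedD; [exact: V'b.2|exact: cbounded_cst].
Qed.

Lemma adj_coef_bounded_measurable lam : bounded_measurable (adj_coef lam).
Proof.
split.
  apply: cmeasurableM; first exact: cmeasurable_cst.
  by apply: cmeasurableD; [apply: cmeasurableJ; exact: V'b.1|exact: cmeasurable_cst].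
apply: cboundedM; first exact: cbounded_cst.
by apply: cboundedD; [apply: cboundedJ; exact: V'b.2|exact: cbounded_cst].
Qed.

Lemma bounded_measurable_cintegrable_sub v x : bounded_measurable v ->
  cintegrable `[0, x] v.
Proof. by move=> h; exact: bounded_measurable_cintegrable. Qed.

(** Since [lam] is real, the conjugate of [adj_coef] is the negative of [gen_coef], and the two
    exponents cancel. *)
Lemma adj_sol_inv lam x : 0 <= x -> conjc (adj_sol lam x) * sol lam x = 1.
Proof.
move=> x0; have iu := bounded_measurable_cintegrable_sub x (adj_coef_bounded_measurable
  lam).
have ju := bounded_measurable_cintegrable_sub x (gen_coef_bounded_measurable lam).
rewrite /adj_sol /sol -cexpJ// -cexpD//; last first.
  have [i1 i2] := iu; split.
    by apply: eq_integrable i1 => // t _ /=; rewrite ReJ.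
  have := RintegrableZl (-1) (measurable_itv _) i2.
  by apply: eq_integrable => // t _ /=; rewrite ImJ mulN1r.
rewrite (_ : (fun t => _) = fun=> 0 +i* 0); last first.
  apply/funext => t; rewrite /adj_coef /gen_coef.
  by apply: complex_ext; rewrite !partsE /=; ring.
by rewrite cexp_cst_im// mul0r cos0 sin0.
Qed.

Lemma adj_sol_neq0 lam x : adj_sol lam x != 0.
Proof. exact: cexp_neq0. Qed.

Lemma is_H1_cexp v c : bounded_measurable v ->
  is_H1 (fun x => c * cexp v x) (fun x => v x * (c * cexp v x)).
Proof.
move=> bv; have := variation_of_constants c bv (is_L2_cst 0).
have z x : cintegral `[0, x] (fun=> 0 : R[i]) = 0.
  transitivity (cintegral `[0, x] (fun t => 0 * v t)).
    by apply: eq_cintegral => t _; rewrite mul0r.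
  by rewrite cintegralZ ?mul0r//; exact: bounded_measurable_cintegrable_sub.
by congr is_H1; apply/funext => x; rewrite z addr0 ?mulr0 ?addr0 (mulrC c).
Qed.

Lemma cintegral_point y : cintegral `[0, 0] y = 0.
Proof. by rewrite /cintegral set_itv1 !Rintegral_set1. Qed.

(* For g = sol * W with W' = w of mean zero, (A - lam) g = i sol w. *)
Lemma orth_range_adj_sol lam rho k f :
  (forall g g', shift_op (Aop V rho k) lam%:C (g, g') -> ip2 f g' = 0) ->
  exists c, represents (fun x => c * adj_sol lam x) f.
Proof.
move=> orth.
have Lf := L2repr_is_L2 f.
have be := gen_coef_bounded_measurable lam.
have [mE bE] := cexp_L2 be; rewrite -/(sol lam) in mE bE.
(* The du Bois-Reymond argument: the test function [w] is the conjugate of the deviation of [ph]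
   from its mean [m]. *)
pose ph x := sol lam x * conjc (L2repr f x).
have Lph : is_L2 ph by apply: is_L2M => //; exact: is_L2J.
pose m := cintegral I ph / T%:C.
have T0 : (T%:C : R[i]) != 0 by apply/eqP => -[] h; have := @twopi_gt0 R;
  rewrite h ltxx.
pose d x := ph x + (- m).
have Ld : is_L2 d by apply: is_L2D => //; exact: is_L2_cst.
pose w x := conjc (d x).
have Lw : is_L2 w by exact: is_L2J.
have id0 : cintegral I d = 0.
  rewrite cintegralD; [|exact: measurable_I02pi|exact:
    is_L2_cintegrable_open|exact/is_L2_cintegrable_open/is_L2_cst].
  rewrite (_ : cintegral I (fun=> - m) = - m * T%:C).
    by rewrite /m; field.
  by apply: complex_ext; rewrite !partsE /= Rintegral_I_cst ?partsE; ring.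
have iw0 : cintegral I w = 0.
  by rewrite cintegralJ ?id0 ?conjc0//;
    [exact: measurable_I02pi|exact: is_L2_cintegrable_open].
have Hu := variation_of_constants 0 be Lw; rewrite -/(sol lam) in Hu.
set u := (X in is_H1 X _) in Hu.
have u0 : u 0 = 0 by rewrite /u cintegral_point addr0 mulr0.
have uT : u T = 0 by rewrite /u -cintegral_openE// iw0 addr0 mulr0.
have Lu : is_L2 u by have /is_H1P[_ /cabscont_is_L2] := Hu.
have [g gu] := represents_ex Lu.
have Lg' : is_L2 (fun x => 'i%C * (sol lam x * w x)).
  by apply: is_L2Z; exact: is_L2M.
have [g' gu'] := represents_ex Lg'.
(* Both end values of [u] vanish, so the boundary condition holds for every [rho] and the term with
   [k] drops out. *)
have S : shift_op (Aop V rho k) lam%:C (g, g').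
  rewrite /shift_op /=; eexists; eexists; split; [exact: Hu| | |] => //=.
    by rewrite u0 uT mulr0.
  rewrite addrC; apply: represents_ae (represents_lin lam%:C gu gu') _.
  apply: ae_itv1 VV' => x _ ->; rewrite uT mul0r addr0 /gen_coef.
  rewrite -/(u x); move: (u x) (sol lam x * w x) (V' x) => U S v.
  by apply: complex_ext; rewrite !partsE /=; ring.
have := orth _ _ S.
rewrite (ip2E Lf Lg' (represents_repr f) gu').
(* As [w] has mean zero, [ph] may be replaced by ph - m, the conjugate of [w]; the pairing becomes i
   times the squared norm of [w]. *)
have -> : cintegral I (fun x => conjc (L2repr f x) * ('i%C * (sol lam x * w x))) =
  'i%C * (sqnorm w)%:C.
  have Iph : cintegrable I (fun x => ph x * w x).
    have := is_L2_prod_cintegrable (is_L2J Lph) Lw.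
    by congr cintegrable; apply/funext => x; rewrite conjcK.
  have Iw := is_L2_cintegrable_open Lw.
  transitivity (cintegral I (fun x => 'i%C * (ph x * w x))).
    by apply: eq_cintegral => x _; rewrite /ph; ring.
  rewrite cintegralZ//; last exact: measurable_I02pi.
  congr (_ * _); rewrite -cintegral_sqnorm//.
  have -> : cintegral I (fun x => conjc (w x) * w x) =
     cintegral I (fun x => ph x * w x + (- m) * w x).
    by apply: eq_cintegral => x _; rewrite /w conjcK /d; ring.
  rewrite cintegralD//; [|exact: measurable_I02pi|by apply: cintegrableZ => //;
    exact: measurable_I02pi].
  by rewrite cintegralZ ?iw0 ?mulr0 ?addr0//; exact: measurable_I02pi.
move=> /eqP; rewrite mulf_eq0 => /orP[|/eqP[]].
  by rewrite eq_complex /= oner_eq0 andbF.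
move=> /(sqnorm_eq0 Lw) w0.
(* Almost everywhere E conj f = m, that is conj f = m conj F. *)
exists (conjc m); apply: represents_ae (represents_repr f) _.
apply: ae_itv1 w0 => x /itv02piP/andP[/ltW x0 _] wx.
have dx : ph x = m.
  have : d x = 0 by rewrite -(conjcK (d x)) -/(w x) wx conjc0.
  by rewrite /d => /eqP; rewrite addr_eq0 opprK => /eqP.
have := adj_sol_inv lam x0; rewrite -dx /ph => inv.
have inv' : adj_sol lam x * conjc (sol lam x) = 1.
  by rewrite -[LHS]conjcK conjcM conjcK inv conjc1.
by rewrite conjcM conjcK mulrAC (mulrC (conjc _)) inv' mul1r.
Qed.

Lemma real_eigenfunction lam rho k f :
  dissipative (@ip2 R) (Aop V rho k) -> op_eigenspace (Aop V rho k) lam%:C f ->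
  exists c, represents (fun x => c * adj_sol lam x) f.
Proof.
move=> diss Ef; apply: (@orth_range_adj_sol lam rho k) => g g'.
exact: real_eigenvector_orth.
Qed.

Lemma real_eigenvalue_data lam rho k :
  dissipative (@ip2 R) (Aop V rho k) -> op_eigenvalue (Aop V rho k) lam%:C ->
  1 = rho * adj_sol lam T /\
  ae_itv (fun x => L2repr k x =
    (adj_sol lam T)^-1 * ((- 2 * Im (V x))%:C * 'i%C * adj_sol lam x)).
Proof.
move=> diss [f Ef f0].
have [c cf] := real_eigenfunction diss Ef.
have c0 : c != 0.
  apply: contra f0 => /eqP c0; apply/eqP; apply: represents_inj represents_0.
  by apply: represents_ae cf _; apply: ae_itvW => x _; rewrite c0 mul0r.
case: (Ef) => u [du [/is_H1P[_ ac] bc fu _]].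
have Hc := is_H1_cexp c (adj_coef_bounded_measurable lam);
  rewrite -/(adj_sol lam) in Hc.
have [_ acc] := (is_H1P _ _).1 Hc.
(* Two absolutely continuous representatives of [f] agree everywhere, so the boundary condition
   passes to c F. *)
have uc : forall x, 0 <= x <= T -> u x = c * adj_sol lam x.
  by apply: cabscont_ae_eq ac acc _; exact: represents_ae_eq fu cf.
have T0 := @twopi_ge0 R.
have bc' : c * adj_sol lam 0 = rho * (c * adj_sol lam T).
  by rewrite -!uc ?lexx ?T0.
have Fn := adj_sol_neq0 lam T.
split.
  by apply: (mulfI c0); rewrite mulr1 mulrCA -bc' /adj_sol cexp0 mulr1.
have Lk := L2repr_is_L2 k.
have bV := (gen_coef_bounded_measurable lam).
have LcF : is_L2 (fun x => c * adj_sol lam x) by apply: cabscont_is_L2 acc.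
have [mV' bV'] := bounded_measurableI V'b.
have [mJ bJ] := bounded_measurableI (adj_coef_bounded_measurable lam).
have L' : is_L2 (fun x => 'i%C * (adj_coef lam x * (c * adj_sol lam x)) +
   V' x * (c * adj_sol lam x) + c * adj_sol lam T * L2repr k x).
  apply: is_L2D; last exact: is_L2Z.
  by apply: is_L2D; [apply: is_L2Z|]; apply: is_L2M.
have [g gL] := represents_ex L'.
(* The derivative that comes with [u] is not compared with that of c F. Instead c F is placed in the
   graph with its own derivative, and single-valuedness of the operator identifies the two images of
   [f]. *)
have Ag : Aop V rho k (f, g).
  exists (fun x => c * adj_sol lam x), (fun x => adj_coef lam x * (c * adj_sol lam x)).
  split=> //; apply: represents_ae gL _.
  by apply: ae_itv1 VV' => x _ ->.
have [[_ _ fn] _ _] := diss.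
have gE := fn _ _ _ Ag Ef; rewrite /= add0r in gE.
have lf := represents_lin lam%:C cf represents_0; rewrite addr0 -gE in lf.
have := represents_ae_eq gL lf.
apply: ae_itv2 VV' => x _ -> e.
(* Since i F' = (lam - conj V') F, the equation for c F reduces to c F(2 pi) k = (conj V' - V') c
   F. *)
apply: (mulfI (mulf_neq0 c0 Fn)).
apply: (addrI ('i%C * (adj_coef lam x * (c * adj_sol lam x)) + V' x * (c * adj_sol lam
  x))).
rewrite e addr0.
rewrite (_ : c * adj_sol lam T * _ = c * (adj_sol lam T / adj_sol lam T) *
  ((- 2 * Im (V' x))%:C * 'i%C * adj_sol lam x)); last by ring.
rewrite divff// mulr1 /adj_coef; move: (c) (adj_sol lam x) (V' x) => a s v.
by apply: complex_ext; rewrite !partsE /=; ring.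
Qed.

End FirstOrderOperator.

(** * The resolvent *)

Section Resolvent.
Context {R : realType}.
Local Notation leb := (@lebesgue_measure R).
Local Notation T := (twopi R).
Local Notation I := (@itv02pi R).
Variables V V' : R -> R[i].
Hypothesis V'b : bounded_measurable V'.
Hypothesis VV' : ae_itv (fun x => V x = V' x).
Variables (lam : R) (rho : R[i]) (k : L2 R).
Implicit Types (u v w y : R -> R[i]) (f g h : L2 R) (b : R[i]).
Local Notation S := (sol V' lam).
Local Notation A := (Aop V rho k).

(** For x >= 0 this is 1 / (i E). With u = E W and [b] for u(2 pi), the equation (A - lam) u = h
    becomes W' = [kernel] (h - b k), whose right-hand side is [source]. *)
Definition kernel x : R[i] := - 'i%C * conjc (adj_sol V' lam x).
Definition source b h x : R[i] :=
  (- b) * (kernel x * L2repr k x) + kernel x * L2repr h x.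
(* Variation of constants for (A - lam) u = h with b in place of u (2 pi);
   it is a solution as soon as its own value at 2 pi is b. *)
Definition candidate b h x : R[i] := S x * (rho * b + cintegral `[0, x] (source b h)).

Lemma kernel_bounded : cmeasurable I kernel /\ cbounded I kernel.
Proof.
have [m b] := cexp_L2 (adj_coef_bounded_measurable V'b lam); split.
  by apply: cmeasurableM; [exact: cmeasurable_cst|exact: cmeasurableJ].
by apply: cboundedM; [exact: cbounded_cst|exact: cboundedJ].
Qed.

Lemma is_L2_kernelM h : is_L2 (fun x => kernel x * L2repr h x).
Proof. by have [m b] := kernel_bounded; apply: is_L2M => //; exact: L2repr_is_L2. Qed.

Lemma is_L2_source b h : is_L2 (source b h).
Proof.
by apply: is_L2D; [apply: is_L2Z|]; exact: is_L2_kernelM.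
Qed.

Lemma candidate_is_H1 b h : is_H1 (candidate b h)
  (fun x => gen_coef V' lam x * candidate b h x + S x * source b h x).
Proof. exact: variation_of_constants (gen_coef_bounded_measurable V'b lam)
  (is_L2_source b h). Qed.

Lemma candidate_is_L2 b h : is_L2 (candidate b h).
Proof. by have /is_H1P[_ /cabscont_is_L2] := candidate_is_H1 b h. Qed.

Lemma candidate_solves b h : candidate b h T = b ->
  exists2 f, represents (candidate b h) f & shift_op A lam%:C (f, h).
Proof.
move=> uT; have Lu := candidate_is_L2 b h.
have [f fu] := represents_ex Lu; exists f => //.
rewrite /shift_op /=; exists (candidate b h); eexists; split;
  [exact: candidate_is_H1| |by []|].
  by rewrite uT {1}/candidate cintegral_point addr0 {1}/sol cexp0 mul1r.
rewrite addrC; apply: represents_ae (represents_lin lam%:C fu (represents_repr h)) _.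
apply: ae_itv2 VV' (ae_itvW (fun x Ix => Ix)) => x _ -> /itv02piP/andP[/ltW x0 _].
rewrite uT /source /kernel /gen_coef.
have := adj_sol_inv V'b lam x0.
move: (adj_sol V' lam x) (S x) (candidate b h x) (L2repr h x) (L2repr k x) (V' x) => F
  E u z kx v FE.
transitivity (('i%C * 'i%C) * ((v - lam%:C) * u) -
  ('i%C * 'i%C) * (conjc F * E * (z - b * kx)) + v * u + b * kx).
  by rewrite sqr_i2 FE; ring.
by ring.
Qed.

Definition char_coef := 1 - S T * (rho - cintegral `[0,
  T] (fun x => kernel x * L2repr k x)).

Lemma candidate_endE b h : candidate b h T =
  b * (1 - char_coef) + S T * cintegral `[0, T] (fun x => kernel x * L2repr h x).
Proof.
rewrite /candidate /source /char_coef.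
have ik := is_L2_cintegrable (is_L2_kernelM k);
  have ih := is_L2_cintegrable (is_L2_kernelM h).
rewrite cintegralD//; last exact: cintegrableZ.
by rewrite cintegralZ//; ring.
Qed.

Lemma candidate_bound : char_coef != 0 -> exists2 M, 0 <= M & forall b h,
  candidate b h T = b -> sqnorm (candidate b h) <= M * sqnorm (L2repr h).
Proof.
move=> d0; have T0 := @twopi_ge0 R; have TT : 0 <= T <= T by rewrite T0 lexx.
have [CS CS0 HCS] := cbounded_sqmod (cexp_L2 (gen_coef_bounded_measurable V'b lam)).2.
have [Cq Cq0 HCq] := cbounded_sqmod kernel_bounded.2.
set NK := sqnorm (fun x => kernel x * L2repr k x).
have NK0 : 0 <= NK by exact: sqnorm_ge0.
set beta := sqmod (S T / char_coef) * (T * Cq).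
have beta0 : 0 <= beta by rewrite /beta mulr_ge0 ?sqmod_ge0// mulr_ge0.
set MY := 2 * beta * NK + 2 * Cq.
have MY0 : 0 <= MY by rewrite /MY; repeat (done || apply: addr_ge0 || apply: mulr_ge0).
set M := CS * (2 * sqmod rho * (beta * T) + 2 * (T * MY * T)).
have M0 : 0 <= M by rewrite /M;
  repeat (done || exact: sqmod_ge0 || apply: addr_ge0 || apply: mulr_ge0).
exists M => // b h uT.
set N := sqnorm (L2repr h); have N0 : 0 <= N by exact: sqnorm_ge0.
have Lk := is_L2_kernelM k; have Lh := is_L2_kernelM h.
have Nh : sqnorm (fun x => kernel x * L2repr h x) <= Cq * N.
  apply: le_sqnorm => //; first exact: L2repr_is_L2.
  by move=> x Ix; rewrite sqmodM ler_wpM2r ?sqmod_ge0// HCq.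
have bE : b = S T / char_coef * cintegral `[0, T] (fun x => kernel x * L2repr h x).
  set H := cintegral _ _.
  have e : b = b * (1 - char_coef) + S T * H by rewrite -candidate_endE.
  have bd : b * char_coef = S T * H.
    by transitivity (b - b * (1 - char_coef)); [ring|rewrite {1}e; ring].
  by rewrite mulrAC -bd mulfK.
have Nb : sqmod b <= beta * N.
  rewrite bE sqmodM /beta -mulrA ler_wpM2l ?sqmod_ge0//.
  by apply: le_trans (sqmod_prim Lh TT) _; rewrite -mulrA ler_wpM2l.
have Ly := is_L2_source b h.
have Ny : sqnorm (source b h) <= MY * N.
  apply: le_trans (sqnorm_lin _ Lk Lh) _; rewrite -/NK /MY [leRHS]mulrDl.
  have -> : sqmod (- b) = sqmod b by rewrite !sqmodE !partsE; ring.
  apply: lerD; last by rewrite -mulrA ler_wpM2l.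
  by rewrite (_ : 2 * beta * NK * N = 2 * (beta * N) * NK);
    [rewrite ler_wpM2r// ler_wpM2l|ring].
have acY := cabscont_prim (rho * b) (is_L2_cintegrable Ly).
have LY := cabscont_is_L2 acY.
apply: (@le_trans _ _ (CS * sqnorm (fun x => rho * b + cintegral `[0,
  x] (source b h)))).
  apply: le_sqnorm => //; first exact: candidate_is_L2.
  by move=> x Ix; rewrite sqmodM ler_wpM2r ?sqmod_ge0// HCS.
rewrite /M -mulrA ler_wpM2l//.
have LP : is_L2 (fun x => cintegral `[0, x] (source b h)).
  have := cabscont_is_L2 (cabscont_prim 0 (is_L2_cintegrable Ly)).
  by congr is_L2; apply/funext => x; rewrite add0r.
apply: le_trans (sqnorm_lin rho (is_L2_cst b) LP) _.
rewrite sqnorm_cst [leRHS]mulrDl; apply: lerD.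
  rewrite (_ : 2 * sqmod rho * (beta * T) * N = 2 * sqmod rho * (beta * N * T));
    last by ring.
  by apply: ler_wpM2l; [rewrite mulr_ge0 ?sqmod_ge0|exact: ler_wpM2r].
rewrite (_ : 2 * (T * MY * T) * N = 2 * ((T * (MY * N)) * T)); last by ring.
rewrite ler_wpM2l//.
rewrite -Rintegral_I_cst; apply: le_Rintegral;
  [exact: measurable_I02pi|exact: is_L2_Rintegrable|exact: Rintegrable_cst_itv|].
move=> x /itv02pi_sub; rewrite /= in_itv/= => xT.
by apply: le_trans (sqmod_prim Ly xT) _; rewrite ler_wpM2l.
Qed.

Lemma spectrum_eigenvalue : linear_operator A ->
  spectrum (@ip2 R) A lam%:C -> op_eigenvalue A lam%:C.
Proof.
move=> Alin sp; apply: contrapT => noev; apply: sp.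
have ker0 f : shift_op A lam%:C (f, 0) -> f = 0.
  by move=> Sf; apply/eqP/negP => /negP f0; apply: noev; exists f.
have [d0|d0] := eqVneq char_coef 0.
  have e : candidate 1 0 T = 1.
    rewrite candidate_endE d0 subr0 mul1r.
    have ae0 : ae_itv (fun x => kernel x * L2repr 0 x = 0).
      by apply: ae_itv1 (@represents_0 R) => x _ ->; rewrite mulr0.
    rewrite -cintegral_openE; last exact: is_L2_kernelM.
    rewrite (ae_eq_cintegral (v := fun=> 0) _ _ _ ae0); first last.
    - exact: cmeasurable_cst.
    - exact: (is_L2_kernelM 0).1.
    - exact: measurable_I02pi.
    rewrite /cintegral !Rintegral_I_cst mul0r.
    by rewrite (_ : 0 +i* 0 = 0)// mulr0 addr0.
  have [f fu /ker0 f0] := candidate_solves e; rewrite f0 in fu.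
  have /is_H1P[_ ac] := candidate_is_H1 1 0.
  have z : cabscont T (fun=> 0 : R[i]) (fun=> 0).
    have := cabscont_prim 0 (is_L2_cintegrable (is_L2_cst (0 : R[i]))).
    congr cabscont; apply/funext => x; rewrite add0r /cintegral /=.
    have I0 (D : set R) : (\int[leb]_(x in D) (0 : R))%R = 0.
      by rewrite /Rintegral integral0.
    by rewrite !I0.
  have := cabscont_ae_eq ac z (represents_ae_eq fu (@represents_0 R)).
  move=> /(_ T); rewrite twopi_ge0 lexx e => /(_ isT) /eqP.
  by rewrite oner_eq0.
have [M M0 HM] := candidate_bound d0.
have ex h : exists b, candidate b h T = b.
  exists (S T * cintegral `[0, T] (fun x => kernel x * L2repr h x) / char_coef).
  by rewrite candidate_endE; field.
have uniq f f' h : shift_op A lam%:C (f, h) -> shift_op A lam%:C (f', h) -> f = f'.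
  move=> S1 S2; apply/eqP; rewrite -subr_eq0; apply/eqP/ker0.
  have [_ L _] := Alin; have := L (-1) _ _ _ _ S2 S1.
  rewrite /shift_op /= !scaleN1r; congr A; rewrite (addrC (- f')); congr pair.
  by rewrite add0r scalerBr opprD addrACA addNr add0r addrC.
split.
  move=> h; have [b /candidate_solves[f _ Sf]] := ex h.
  by exists f; split=> // f' Sf'; exact: uniq Sf Sf'.
exists (Num.sqrt M) => f h Sf.
have [b uT] := ex h; have [f' fu Sf'] := candidate_solves uT.
rewrite (uniq _ _ _ Sf Sf') (hnormE (candidate_is_L2 b h) fu).
rewrite (hnormE (L2repr_is_L2 h) (represents_repr h)) -sqrtrM//.
by rewrite ler_wsqrtr// HM.
Qed.

End Resolvent.

(** * Uniqueness and simplicity of the real eigenvalue *)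

Section Uniqueness.
Context {R : realType}.
Local Notation leb := (@lebesgue_measure R).
Local Notation T := (twopi R).
Local Notation I := (@itv02pi R).

Lemma negligible_cos_eq1 (a : R) : a != 0 ->
  leb.-negligible [set x | cos (a * x) = 1].
Proof.
move=> a0; set Z := [set x | _].
have key x y : Z x -> Z y -> x < y -> pi <= `|a| * (y - x).
  rewrite /Z /= => cx cy xy; rewrite leNgt; apply/negP => lt.
  have s0 (t : R) : cos t = 1 -> sin t = 0.
    by move=> ct; apply/eqP; rewrite -norm_cos_eq1 ct normr1.
  have : sin (a * (y - x)) = 0.
    by rewrite mulrBr sinB (s0 _ cx) (s0 _ cy) mul0r mulr0 subrr.
  have pos : 0 < `|a| * (y - x) by rewrite mulr_gt0 ?normr_gt0// subr_gt0.
  have : 0 < sin (`|a| * (y - x)) by apply: sin_gt0_pi; rewrite pos.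
  have [_|_] := ger0P a; last by rewrite mulNr sinN => h h0; rewrite h0 oppr0 ltxx in h.
  by move=> h h0; rewrite h0 ltxx in h.
have cz : countable Z.
  apply/countable_injP.
  exists (fun x => pickle (Num.floor (`|a| * x / pi))) => x y /set_mem Zx /set_mem Zy.
  move=> /(pcan_inj pickleK) e; apply/eqP; rewrite eq_le; apply/andP.
  have p0 := pi_gt0 R.
  have lt (u v : R) : Num.floor (`|a| * u / pi) = Num.floor (`|a| * v / pi) ->
    `|a| * (v - u) < pi.
    move=> E; have := floor_le (`|a| * u / pi); have := floorD1_gt (`|a| * v / pi).
    rewrite E intrD; set n := (Num.floor _)%:~R => h1 h2.
    have : `|a| * v / pi - `|a| * u / pi < 1 by rewrite [1%:~R]mulr1z in h1; lra.
    by rewrite -mulrBl ltr_pdivrMr// mul1r -mulrBr.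
  split; rewrite leNgt; apply/negP => xy.
    by have := key _ _ Zy Zx xy; rewrite leNgt lt.
  by have := key _ _ Zx Zy xy; rewrite leNgt lt.
exists Z; split=> //; first by apply: countable_measurable => // t;
  exact: measurable_set1.
exact: countable_lebesgue_measure0.
Qed.

Variables V V' : R -> R[i].
Hypothesis V'b : bounded_measurable V'.
Hypothesis VV' : ae_itv (fun x => V x = V' x).

Lemma adj_sol_shift lam mu x : 0 <= x ->
  adj_sol V' lam x = adj_sol V' mu x * (cos ((mu - lam) * x) +i* sin ((mu - lam) * x)).
Proof.
move=> x0; rewrite -(cexp_cst_im _ x0) /adj_sol.
have -> : adj_coef V' lam = fun t => adj_coef V' mu t + (0 +i* (mu - lam)).
  apply/funext => t; rewrite /adj_coef.
  by apply: complex_ext; rewrite !partsE /=; ring.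
rewrite cexpD//.
- by apply: bounded_measurable_cintegrable; exact: adj_coef_bounded_measurable.
- by split; exact: Rintegrable_cst_itv.
Qed.

Lemma real_eigenvalue_unique (lam mu : R) rho k :
  cmeasurable I V ->
  (0 < leb [set x : R | I x /\ (0 < Im (V x))%R])%E ->
  dissipative (@ip2 R) (Aop V rho k) ->
  op_eigenvalue (Aop V rho k) lam%:C -> op_eigenvalue (Aop V rho k) mu%:C ->
  lam = mu.
Proof.
move=> mV Vpos diss el em; apply/eqP/negP => /negP ne.
have [r1 k1] := real_eigenvalue_data V'b VV' diss el.
have [r2 k2] := real_eigenvalue_data V'b VV' diss em.
have FT : adj_sol V' lam T = adj_sol V' mu T.
  have rho0 : rho != 0 by apply/eqP => h; move: r1 => /eqP; rewrite h mul0r oner_eq0.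
  by apply: (mulfI rho0); rewrite -r1 -r2.
have Fn := adj_sol_neq0 V' mu T.
have ne' : mu - lam != 0 by rewrite subr_eq0 eq_sym.
have ae : ae_itv (fun x => 0 < Im (V x) -> cos ((mu - lam) * x) = 1).
  apply: ae_itv2 k1 k2 => x /itv02piP/andP[/ltW x0 _] -> e Vx.
  move: e; rewrite FT => /(mulfI (invr_neq0 Fn)).
  have c0 : (- 2 * Im (V x))%:C * 'i%C != 0 :> R[i].
    apply/eqP => /(congr1 (@complex.Im R)); rewrite !partsE /= => h; move: Vx h; lra.
  move=> /(mulfI c0); rewrite (adj_sol_shift lam mu x0).
  rewrite -[RHS]mulr1 => /(mulfI (adj_sol_neq0 V' mu x)).
  by move=> /(congr1 (@complex.Re R)).
have mO : measurable [set x : R | I x /\ 0 < Im (V x)].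
  have [_ m] := mV; have := m (@measurable_I02pi R) `]0,
    +oo[%classic (measurable_itv _).
  congr measurable; apply/seteqP; split=> x /=; rewrite in_itv/= andbT; tauto.
have nO : leb.-negligible [set x : R | I x /\ 0 < Im (V x)].
  apply: negligibleS (negligibleU ae (negligible_cos_eq1 ne')) => x [Ix Vx].
  have [c1|c1] := pselect (cos ((mu - lam) * x) = 1); first by right.
  by left=> /= h; apply: c1; exact: h.
have O0 : leb [set x : R | I x /\ 0 < Im (V x)] = 0 by exact/negligibleP.
by move: Vpos; rewrite O0 ltxx.
Qed.

Lemma real_eigenvalue_determines (lam : R) rho1 rho2 k1 k2 :
  dissipative (@ip2 R) (Aop V rho1 k1) -> op_eigenvalue (Aop V rho1 k1) lam%:C ->
  dissipative (@ip2 R) (Aop V rho2 k2) -> op_eigenvalue (Aop V rho2 k2) lam%:C ->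
  rho1 = rho2 /\ k1 = k2.
Proof.
move=> d1 e1 d2 e2.
have [r1 f1] := real_eigenvalue_data V'b VV' d1 e1.
have [r2 f2] := real_eigenvalue_data V'b VV' d2 e2.
split; last exact: represents_inj f1 f2.
by apply: (mulIf (adj_sol_neq0 V' lam T)); rewrite -r1 -r2.
Qed.

Lemma real_eigenvalue_simple (lam : R) rho k :
  dissipative (@ip2 R) (Aop V rho k) -> op_eigenvalue (Aop V rho k) lam%:C ->
  algebraic_multiplicity (Aop V rho k) lam%:C 1.
Proof.
move=> diss [e Ee e0].
have [c ce] := real_eigenfunction V'b VV' diss Ee.
have c0 : c != 0.
  apply: contra e0 => /eqP c0; apply/eqP; apply: represents_inj represents_0.
  by apply: represents_ae ce _; apply: ae_itvW => x _; rewrite c0 mul0r.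
exists (fun=> e); split.
  move=> a; rewrite big_ord1 => ae i; rewrite (ord1 i); apply/eqP; apply: contraT => a0.
  by move: e0; rewrite -(scale1r e) -(mulVf a0) -scalerA ae scaler0 eqxx.
rewrite root_space_real//; apply/seteqP; split=> f.
  move=> Ef; have [d df] := real_eigenfunction V'b VV' diss Ef.
  exists (fun=> d / c); rewrite big_ord1; apply: represents_inj df _.
  have := represents_lin (d / c) ce represents_0; rewrite addr0 => h.
  by apply: represents_ae h _; apply: ae_itvW => x _; rewrite addr0 mulrA divfK.
case=> a ->; rewrite big_ord1; rewrite /op_eigenspace /=.
have z : shift_op (Aop V rho k) lam%:C (0, 0).
  by rewrite /shift_op /= scaler0 addr0; case: diss => -[].
have := shift_op_linear diss (a ord0) Ee z.
by rewrite scaler0 !addr0.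
Qed.

End Uniqueness.

Theorem theorem4p7 (R : realType) (V : R -> R[i])
  (V_bounded : is_Linfty V)
  (V_ge0 : {ae @lebesgue_measure R, forall x : R,
     @itv02pi R x -> 0 <= complex.Im (V x)})
  (V_gt0 : (0 < @lebesgue_measure R
     [set x : R | @itv02pi R x /\ (0 < complex.Im (V x))%R])%E)
  (rho : R[i]) (k : L2 R)
  (A_maxdiss : maxdiss_extension V rho k) :
  [/\ (* (i) *)
      forall lam : R, spectrum (@ip2 R) (Aop V rho k) lam%:C ->
        algebraic_multiplicity (Aop V rho k) lam%:C 1,
      (* (ii) *)
      forall lam mu : R, spectrum (@ip2 R) (Aop V rho k) lam%:C ->
        spectrum (@ip2 R) (Aop V rho k) mu%:C -> lam = mu,
      (* (iii) *)
      forall (lam : R) (rho1 rho2 : R[i]) (k1 k2 : L2 R),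
        maxdiss_extension V rho1 k1 ->
        spectrum (@ip2 R) (Aop V rho1 k1) lam%:C ->
        maxdiss_extension V rho2 k2 ->
        spectrum (@ip2 R) (Aop V rho2 k2) lam%:C ->
        rho1 = rho2 /\ k1 = k2 &
      (* (iv) *)
      forall lam : R, op_eigenvalue (Aop V rho k) lam%:C ->
        forall mu : R[i], op_eigenvalue (Aop V rho k) mu -> mu != lam%:C ->
        forall f g : L2 R, op_eigenspace (Aop V rho k) lam%:C f ->
          root_space (Aop V rho k) mu g -> ip2 f g = 0].
Proof.
have [V' V'b VV'] := Linfty_patch V_bounded.
have mV := V_bounded.1.
have ev (lam : R) r q : maxdiss_extension V r q ->
    spectrum (@ip2 R) (Aop V r q) lam%:C -> op_eigenvalue (Aop V r q) lam%:C.
  by move=> [_ [[Alin _ _] _]]; exact: (spectrum_eigenvalue V'b VV').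
have [_ [diss _]] := A_maxdiss.
split.
- by move=> lam /(ev _ _ _ A_maxdiss); exact: (real_eigenvalue_simple V'b VV').
- move=> lam mu /(ev _ _ _ A_maxdiss) el /(ev _ _ _ A_maxdiss) em.
  exact: (real_eigenvalue_unique V'b VV' mV V_gt0 diss).
- move=> lam rho1 rho2 k1 k2 m1 /(ev _ _ _ m1) e1 m2 /(ev _ _ _ m2) e2.
  by apply: (real_eigenvalue_determines V'b VV' _ e1 _ e2); [case: m1 => _ []|case: m2 => _ []].
- move=> lam _ mu _ ne f g Ef Rg; exact: (real_eigenvector_orth_root diss ne Ef Rg).
Qed.
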